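(* Let $m$, $n$ and $d$ be positive integers with $m<d$, and let $b$ be a real number with $b\notin \mathbb{Z}/d$. Put $t_1=e^{-2\pi i mb}$, $t_2=e^{-2\pi i db}$, $t_1'=e^{2\pi i mb}$ and $t_2'=e^{2\pi i db}$. Then $$\sum_{j=1}^{d-1} \sin\Big(\frac{2\pi mj}{d}\Big)\cot^n\Big(\frac{\pi j}{d}+\pi b\Big) = -\sum i^{\mu+\nu}\,2^{\mu+\nu}\,\frac{m^\mu}{\mu!}\,\frac{d^{\nu+1}}{\nu!}\Big(t_1 A_\nu(t_2)+(-1)^{\mu+\nu}t_1' A_\nu(t_2')\Big)D(j_1,\ldots,j_n),$$ where the sum on the right is over all nonnegative integers $j_1,\ldots,j_n,\mu,\nu$ such that $2j_1+\cdots+2j_n+\mu+\nu=n-1$.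
   Context: Here $i$ is the imaginary unit and $\mathbb{Z}/d=\{k/d : k\in\mathbb{Z}\}$. For a complex number $t\neq 1$, the numbers $A_\nu(t)$, $\nu\ge 0$, are defined by the power series expansion about $z=0$: $\frac{1}{te^z-1}=\sum_{\nu=0}^{\infty}\frac{A_\nu(t)}{\nu!}z^\nu$ (e.g. $A_0(t)=\frac{1}{t-1}$, $A_1(t)=\frac{-t}{(t-1)^2}$). For $j\ge 0$, $C_j=\frac{(-1)^j2^{2j}B_{2j}}{(2j)!}$, where $B_k$ are the Bernoulli numbers ($\frac{x}{e^x-1}=\sum_{k\ge 0}B_k\frac{x^k}{k!}$); thus $C_0=1$, $C_1=-\frac13$, $C_2=-\frac1{45}$, and these are the coefficients in $\cot(\pi w)=\sum_{j\ge 0}C_j\pi^{2j-1}w^{2j-1}$ near $w=0$. Finally $D(j_1,\ldots,j_n)=\prod_{r=1}^{n}C_{j_r}$. *)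

(* Defs.v *)
From HB Require Import structures.
From mathcomp Require Import all_boot all_order all_algebra.
From mathcomp Require Import all_classical all_reals all_analysis.
From mathcomp Require Import complex.
Import Order.TTheory GRing.Theory Num.Theory numFieldNormedType.Exports.

Set Implicit Arguments.
Unset Strict Implicit.
Unset Printing Implicit Defensive.

Local Open Scope classical_set_scope.
Local Open Scope ring_scope.

(* f z = \sum_k c_k / k! z^k, the series converging to f on a neighbourhood
   of 0. *)
Definition is_expansion0 (K : numFieldType) (f : K -> K) (c : nat -> K) : Prop :=
  \forall z \near (0 : K),
    series (fun k => c k / k`!%:R * z ^+ k) @ \oo --> f z.

(* Such a sequence is unique when it exists; 0 is the junk value when none
   does. *)
Definition expansion0 (K : numFieldType) (f : K -> K) : nat -> K :=
  xget (fun=> 0) [set c | is_expansion0 f c].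

Definition expC (R : realType) (z : R[i]) : R[i] :=
  (expR (complex.Re z))%:C%C * (cos (complex.Im z) +i* sin (complex.Im z))%C.

(* \sum_nu A_nu(t) / nu! z^nu = 1 / (t e^z - 1); meaningful for t != 1. *)
Definition Acoef (R : realType) (nu : nat) (t : R[i]) : R[i] :=
  expansion0 (fun z => (t * expC z - 1)^-1) nu.

(* The removable singularity of x / (e^x - 1) at 0 is filled in by hand, since
   division by 0 gives 0. *)
Definition bernoulli_gen (R : realType) (x : R) : R :=
  if x == 0 then 1 else x / (expR x - 1).

Definition bernoulli_num (R : realType) (k : nat) : R :=
  expansion0 (@bernoulli_gen R) k.

Definition cot (R : realType) (x : R) : R := cos x / sin x.

Definition Ccoef (R : realType) (j : nat) : R :=
  (-1) ^+ j * 2 ^+ (2 * j) * bernoulli_num R (2 * j) / (2 * j)`!%:R.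

Definition Dcoef (R : realType) (n : nat) (j : 'I_n -> nat) : R :=
  \prod_(r < n) Ccoef R (j r).

(* Main.v *)
Require Import Defs.
From HB Require Import structures.
From mathcomp Require Import all_boot all_order all_algebra.
From mathcomp Require Import all_classical all_reals all_analysis.
From mathcomp Require Import complex.
From mathcomp Require Import ring zify.
Import Order.TTheory GRing.Theory Num.Theory numFieldNormedType.Exports.

Set Implicit Arguments.
Unset Strict Implicit.
Unset Printing Implicit Defensive.

Local Open Scope ring_scope.

(** The sum is a residue sum.  Put [x_j = pi j / d + pi b] and
    [w_j = e^(2 i x_j)].  The [w_j] are the [d] roots of [w^d = T], where
    [T = e^(2 pi i d b)] differs from [1] because [d b] is not an integer, and
    [cot x_j = i (w_j + 1) / (w_j - 1)].  Since
    [sin (2 pi m j / d) = (t1 w_j^m - t1' w_j^(-m)) / (2 i)], the sum splits into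
    two sums of type [w_j^m cot^n x_j], the second one for the inverses of the
    [w_j] (cotangent being odd).

    The classical evaluation of such a sum moves the residues at the [x_j] of
    [cot^n] times a kernel to the pole of [cot^n] at [0].  Here residues at [0]
    are coefficients of formal power series, and no contour is needed.  The
    function [k(z) = cot (x - z)] satisfies [k' = 1 + k^2], and [cot' = - 1 - cot^2];
    integrating by parts, the residue of [cot^n k] at [0] is [k(0)^n = cot^n x] up
    to a constant that depends on [n] only (lemmas [coef_cot_residue] and
    [cot_residue_riccati]).  As [0 < m < d], the weights [w_j^m] have sum [0], so
    the constants cancel, and the weighted sum of the kernels is
    [- 2 i d e^(2 i m z) / (T^-1 e^(2 i d z) - 1)] by a geometric series and the
    vanishing of the power sums of the [w_j] (lemma [power_sum_cot]).  The
    right-hand side of the theorem collects the coefficients of order [n - 1] of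
    [(z cot z)^n] times this function and times its analogue for [T^-1], written
    out by distributivity (lemma [coef_even_exp_mul]); the parity of [z cot z]
    leaves only even exponents.

    It remains to identify the numbers [A_nu(t)] and [B_k], which are defined by
    convergent expansions, with coefficients of formal inverses (lemmas [AcoefE]
    and [bernoulli_numE]).  An expansion is unique ([is_expansion0_unique]), and
    the formal inverse of a series with bounded coefficients converges near [0]
    to the reciprocal of its sum ([expansion0_inverse]). *)

(** * The ring of formal power series *)

(** A record rather than a bare function type, so that the convolution product
    does not clash with the pointwise ring structure on functions. *)
Record fps (K : Type) := Fps { coef : nat -> K }.

Lemma fpsP (K : Type) (a b : fps K) : coef a =1 coef b -> a = b.
Proof. by case: a b => [a] [b] /= ab; congr Fps; apply/funext. Qed.

HB.instance Definition _ (K : Type) := gen_eqMixin (fps K).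
HB.instance Definition _ (K : Type) := gen_choiceMixin (fps K).

Section FpsRing.
Variable K : comNzRingType.
Implicit Types (a b : fps K) (c : K).

Definition fps0 : fps K := Fps (fun=> 0).
Definition fps1 : fps K := Fps (fun k => (k == 0%N)%:R).
Definition fps_opp a := Fps (fun k => - coef a k).
Definition fps_add a b := Fps (fun k => coef a k + coef b k).
Definition fps_mul a b :=
  Fps (fun k => \sum_(i < k.+1) coef a i * coef b (k - i)).

Lemma fps_addA : associative fps_add.
Proof. by move=> a b c; apply: fpsP => k /=; rewrite addrA. Qed.

Lemma fps_addC : commutative fps_add.
Proof. by move=> a b; apply: fpsP => k /=; rewrite addrC. Qed.

Lemma fps_add0 : left_id fps0 fps_add.
Proof. by move=> a; apply: fpsP => k /=; rewrite add0r. Qed.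

Lemma fps_addN : left_inverse fps0 fps_opp fps_add.
Proof. by move=> a; apply: fpsP => k /=; rewrite addNr. Qed.

HB.instance Definition _ :=
  GRing.isZmodule.Build (fps K) fps_addA fps_addC fps_add0 fps_addN.

(** Coefficients of order less than [N] are those of polynomials, so the ring
    laws are inherited from [{poly K}]. *)
Definition fps_trunc N a : {poly K} := \poly_(i < N) coef a i.

Lemma coef_fps_mul_trunc N a b k : (k < N)%N ->
  coef (fps_mul a b) k = (fps_trunc N a * fps_trunc N b)`_k.
Proof.
move=> ltkN; rewrite coefM /=; apply: eq_bigr => i _.
by rewrite !coef_poly !ifT //; [lia|case: i => i /=; lia].
Qed.

Lemma fps_mulC : commutative fps_mul.
Proof.
by move=> a b; apply: fpsP => k; rewrite !(@coef_fps_mul_trunc k.+1) // mulrC.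
Qed.

Lemma fps_mulA : associative fps_mul.
Proof.
move=> a b c; apply: fpsP => k.
have tM x y z : (fps_trunc k.+1 (fps_mul x y) * fps_trunc k.+1 z)`_k
    = (fps_trunc k.+1 x * fps_trunc k.+1 y * fps_trunc k.+1 z)`_k.
  rewrite 2!coefM; apply: eq_bigr => i _; congr (_ * _).
  by rewrite coef_poly ltn_ord (@coef_fps_mul_trunc k.+1).
rewrite [LHS](@coef_fps_mul_trunc k.+1) // [RHS](@coef_fps_mul_trunc k.+1) //.
by rewrite tM mulrC tM [in LHS]mulrC mulrA.
Qed.

Lemma fps_mul1 : left_id fps1 fps_mul.
Proof.
move=> a; apply: fpsP => k /=.
rewrite big_ord_recl subn0 mul1r big1 ?addr0 // => i _.
by rewrite mul0r.
Qed.

Lemma fps_mulD : left_distributive fps_mul fps_add.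
Proof.
move=> a b c; apply: fpsP => k /=; rewrite -big_split /=.
by apply: eq_bigr => i _; rewrite mulrDl.
Qed.

Lemma fps_oner_neq0 : fps1 != fps0.
Proof.
by apply/eqP => /(congr1 (fun a => coef a 0)) /= /eqP; rewrite oner_eq0.
Qed.

HB.instance Definition _ := GRing.Zmodule_isComNzRing.Build (fps K)
  fps_mulA fps_mulC fps_mul1 fps_mulD fps_oner_neq0.

Lemma coef1f k : coef (1 : fps K) k = (k == 0%N)%:R. Proof. by []. Qed.
Lemma coefDf a b k : coef (a + b) k = coef a k + coef b k. Proof. by []. Qed.
Lemma coefBf a b k : coef (a - b) k = coef a k - coef b k. Proof. by []. Qed.
Lemma coefMf a b k :
  coef (a * b) k = \sum_(i < k.+1) coef a i * coef b (k - i).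
Proof. by []. Qed.

Lemma coefM0f a b : coef (a * b) 0 = coef a 0 * coef b 0.
Proof. by rewrite coefMf big_ord_recl big_ord0 addr0. Qed.

Lemma coef_sumf (I : Type) (r : seq I) (P : pred I) (F : I -> fps K) k :
  coef (\sum_(i <- r | P i) F i) k = \sum_(i <- r | P i) coef (F i) k.
Proof. exact: (big_morph (fun a => coef a k) (fun _ _ => erefl) erefl). Qed.

Definition monof c (l : nat) : fps K :=
  Fps (fun k => if k == l then c else 0).

Lemma coef_monoM c l a k :
  coef (monof c l * a) k = if (l <= k)%N then c * coef a (k - l) else 0.
Proof.
rewrite coefMf /=; case: leqP => [lek|ltk].
  rewrite (bigD1 (Ordinal (lek : (l < k.+1)%N))) //= eqxx big1 ?addr0 // => i.
  by rewrite -val_eqE /= => /negbTE ->; rewrite mul0r.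
rewrite big1 // => i _; rewrite ifN ?mul0r //.
by case: i => i /=; lia.
Qed.

Lemma monofM c c' l l' : monof c l * monof c' l' = monof (c * c') (l + l').
Proof.
apply: fpsP => k; rewrite coef_monoM /=; case: leqP => lk.
  have -> : (k - l == l')%N = (k == l + l')%N by lia.
  by case: ifP; rewrite ?mulr0.
by rewrite ifN //; lia.
Qed.

Definition constf (c : K) : fps K := monof c 0.

Lemma coef_constM c a k : coef (constf c * a) k = c * coef a k.
Proof. by rewrite coef_monoM subn0. Qed.

Fact constf_is_zmod : zmod_morphism constf.
Proof. by move=> x y; apply: fpsP => -[|k]; rewrite coefBf //= subr0. Qed.

Fact constf_is_monoid : monoid_morphism constf.
Proof.
split; first by apply: fpsP => -[|k].
by move=> x y; rewrite monofM.
Qed.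

HB.instance Definition _ := GRing.isZmodMorphism.Build K (fps K) constf constf_is_zmod.
HB.instance Definition _ := GRing.isMonoidMorphism.Build K (fps K) constf constf_is_monoid.

Definition varf : fps K := monof 1 1.

Lemma coef_varM a k : coef (varf * a) k = if k is k'.+1 then coef a k' else 0.
Proof. by rewrite coef_monoM; case: k => [|k] //; rewrite mul1r subn1. Qed.

Lemma varf_inj : injective (fun a => varf * a).
Proof.
move=> a b /= eab; apply: fpsP => k.
by have := congr1 (fun u : fps K => coef u k.+1) eab; rewrite !coef_varM.
Qed.

Definition derivf a : fps K := Fps (fun k => k.+1%:R * coef a k.+1).

Fact derivf_is_zmod : zmod_morphism derivf.
Proof. by move=> a b; apply: fpsP => k; exact: mulrBr. Qed.

HB.instance Definition _ := GRing.isZmodMorphism.Build (fps K) (fps K) derivf derivf_is_zmod.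

Lemma coef_varD a k : coef (varf * derivf a) k = k%:R * coef a k.
Proof. by rewrite coef_varM; case: k => [|k] //; rewrite mul0r. Qed.

(** After multiplication by the variable, differentiation weights the
    coefficient of order [k] by [k = i + (k - i)], which splits over a
    convolution. *)
Lemma derivfM a b : derivf (a * b) = derivf a * b + a * derivf b.
Proof.
apply: varf_inj => /=.
rewrite mulrDr mulrA [varf * (a * _)]mulrCA; apply: fpsP => k.
rewrite coef_varD coefDf !coefMf mulr_sumr -big_split; apply: eq_bigr => i _.
have -> : k%:R = (k - i)%:R + i%:R :> K by rewrite -natrD subnK // leq_ord.
rewrite !coef_varD /=; ring.
Qed.

Lemma derivf_const c : derivf (constf c) = 0.
Proof. by apply: fpsP => k /=; rewrite mulr0. Qed.

Lemma derivf_constM c a : derivf (constf c * a) = constf c * derivf a.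
Proof. by rewrite derivfM derivf_const mul0r add0r. Qed.

Lemma derivf1 : derivf 1 = 0.
Proof. by rewrite -(rmorph1 constf) derivf_const. Qed.

Lemma derivfX a n : derivf (a ^+ n.+1) = n.+1%:R * a ^+ n * derivf a.
Proof.
elim: n => [|n IH]; first by rewrite expr0 !mulr1 mul1r expr1.
rewrite exprS derivfM IH [n.+2%:R]mulrS exprS; ring.
Qed.

End FpsRing.

(** * Substitution, inversion and exponentials of formal power series *)

Section FpsMorphisms.
Variables K L : comNzRingType.
Implicit Types (a b : fps K) (c : K).

(** The substitution [X -> c X]. *)
Definition scalef c a : fps K := Fps (fun k => c ^+ k * coef a k).

Fact scalef_is_zmod c : zmod_morphism (scalef c).
Proof. by move=> a b; apply: fpsP => k; exact: mulrBr. Qed.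

Fact scalef_is_monoid c : monoid_morphism (scalef c).
Proof.
split; first by apply: fpsP => -[|k] /=; rewrite ?expr0 ?mulr1 ?mulr0.
move=> a b; apply: fpsP => k.
rewrite coefMf /= mulr_sumr; apply: eq_bigr => i _.
have -> : c ^+ k = c ^+ i * c ^+ (k - i) by rewrite -exprD subnKC // leq_ord.
by rewrite /=; ring.
Qed.

HB.instance Definition _ c :=
  GRing.isZmodMorphism.Build (fps K) (fps K) (scalef c) (scalef_is_zmod c).
HB.instance Definition _ c :=
  GRing.isMonoidMorphism.Build (fps K) (fps K) (scalef c) (scalef_is_monoid c).

Lemma scalef_const c x : scalef c (constf x) = constf x.
Proof. by apply: fpsP => -[|k] /=; rewrite ?expr0 ?mul1r ?mulr0. Qed.

Lemma scalef_varD c a : scalef c (varf K * derivf a) = varf K * derivf (scalef c a).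
Proof.
apply: fpsP => k; transitivity (c ^+ k * coef (varf K * derivf a) k) => //.
by rewrite !coef_varD mulrCA.
Qed.

Lemma scalef_var c : scalef c (varf K) = constf c * varf K.
Proof.
apply: fpsP => k; rewrite coef_constM /=.
by case: eqP => [->|]; rewrite ?mulr0 ?expr1.
Qed.

Definition mapf (f : K -> L) a : fps L := Fps (fun k => f (coef a k)).

Variable f : {rmorphism K -> L}.

Fact mapf_is_zmod : zmod_morphism (mapf f).
Proof. by move=> a b; apply: fpsP => k; exact: rmorphB. Qed.

Fact mapf_is_monoid : monoid_morphism (mapf f).
Proof.
split; first by apply: fpsP => k; exact: rmorph_nat.
move=> a b; apply: fpsP => k.
by rewrite /= rmorph_sum; apply: eq_bigr => i _; rewrite rmorphM.
Qed.

HB.instance Definition _ :=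
  GRing.isZmodMorphism.Build (fps K) (fps L) (mapf f) mapf_is_zmod.
HB.instance Definition _ :=
  GRing.isMonoidMorphism.Build (fps K) (fps L) (mapf f) mapf_is_monoid.

End FpsMorphisms.

Section FpsCongruence.
Variable K : comNzRingType.
Implicit Types (a b : fps K) (c : K).

Definition eqmodX N a b := forall k, (k < N)%N -> coef a k = coef b k.

Lemma eqmodXM N a b a' b' :
  eqmodX N a a' -> eqmodX N b b' -> eqmodX N (a * b) (a' * b').
Proof.
move=> ea eb k ltkN; rewrite !coefMf; apply: eq_bigr => -[i /= lti] _.
by rewrite ea ?eb //; lia.
Qed.

Lemma eqmodX_exp N a b n : eqmodX N a b -> eqmodX N (a ^+ n) (b ^+ n).
Proof.
by move=> ab; elim: n => [|n IH] //; rewrite !exprS; exact: eqmodXM.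
Qed.

Lemma coef_natM n a k : coef (n%:R * a) k = n%:R * coef a k.
Proof. by rewrite -(rmorph_nat (@constf K)) coef_constM. Qed.

Lemma coef_fpsX0 a n : coef (a ^+ n) 0 = coef a 0 ^+ n.
Proof. by elim: n => [|n IH] //; rewrite !exprS coefM0f IH. Qed.

Lemma coef_exp_lt a n k : coef a 0 = 0 -> (k < n)%N -> coef (a ^+ n) k = 0.
Proof.
move=> a0 ltkn.
have -> : a = varf K * Fps (fun k => coef a k.+1).
  by apply: fpsP => -[|j]; rewrite coef_varM.
have varX : varf K ^+ n = monof 1 n.
  elim: {ltkn} n => [|n IH]; first by apply: fpsP => -[|j].
  by rewrite exprS IH monofM mulr1.
by rewrite exprMn varX coef_monoM ifN // -ltnNge.
Qed.

End FpsCongruence.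

Section FpsInverse.
Variable K : fieldType.
Implicit Types (a b : fps K) (c : K).

(** The geometric series in [u = 1 - a / a_0]; as [u] has no constant term, only
    the first [k + 1] powers contribute to the coefficient of order [k]. *)
Definition invfps a : fps K :=
  let u := 1 - constf (coef a 0)^-1 * a in
  Fps (fun k => coef (constf (coef a 0)^-1 * \sum_(i < k.+1) u ^+ i) k).

Lemma mulfps_inv a : coef a 0 != 0 -> a * invfps a = 1.
Proof.
move=> a0; apply: fpsP => k.
set c := constf (coef a 0)^-1; pose u := 1 - c * a.
have u0 : coef u 0 = 0 by rewrite coefBf coef_constM mulVf // coef1f subrr.
have eqV : eqmodX k.+1 (invfps a) (c * \sum_(i < k.+1) u ^+ i).
  move=> j ltjk.
  transitivity (coef (c * \sum_(i < j.+1) u ^+ i) j) => //.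
  rewrite !coef_constM; congr (_ * _).
  rewrite !coef_sumf -(subnKC ltjk) big_split_ord /= [X in _ + X]big1 ?addr0 //.
  by move=> i _; rewrite coef_exp_lt //= leq_addr.
rewrite (@eqmodXM _ k.+1 a _ a _ (fun _ _ => erefl) eqV) // mulrA.
have -> : a * c = 1 - u by rewrite /u; ring.
have -> : (1 - u) * \sum_(i < k.+1) u ^+ i = 1 - u ^+ k.+1.
  by rewrite -opprB mulNr -subrX1 opprB.
by rewrite coefBf coef_exp_lt // subr0.
Qed.

End FpsInverse.

Lemma right_inverse_unique (A : comNzRingType) (a b b' : A) :
  a * b = 1 -> a * b' = 1 -> b = b'.
Proof. by move=> ab ab'; rewrite -[b]mulr1 -ab' mulrA [b * a]mulrC ab mul1r. Qed.

Section FpsExp.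
Variable K : numFieldType.
Implicit Types (c : K).

Definition expf c : fps K := Fps (fun k => c ^+ k / k`!%:R).

Lemma fact_neq0 k : k`!%:R != 0 :> K.
Proof. by rewrite pnatr_eq0 -lt0n fact_gt0. Qed.

Lemma expfD c e : expf (c + e) = expf c * expf e.
Proof.
apply: fpsP => k; rewrite coefMf /= addrC exprDn mulr_suml.
apply: eq_bigr => -[i /= ltik] _.
have := bin_fact (ltik : (i <= k)%N) => /(congr1 (fun x => x%:R : K)).
rewrite !natrM => <-; rewrite -mulr_natr.
have : ('C(k, i))%:R != 0 :> K by rewrite pnatr_eq0 -lt0n bin_gt0.
have := fact_neq0 i; have := fact_neq0 (k - i).
by move=> *; field; apply/and3P.
Qed.

Lemma expf0 : expf 0 = 1.
Proof. by apply: fpsP => -[|k] /=; rewrite ?divr1 // exprS !mul0r. Qed.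

Lemma coef0_expf c : coef (expf c) 0 = 1.
Proof. by rewrite /= divr1. Qed.

Lemma expf_natM c n : expf (n%:R * c) = expf c ^+ n.
Proof.
elim: n => [|n IH]; first by rewrite mul0r expf0.
by rewrite mulrS mulrDl mul1r expfD IH exprS.
Qed.

Lemma derivf_exp c : derivf (expf c) = constf c * expf c.
Proof.
apply: fpsP => k; rewrite coef_constM /= factS natrM exprS.
have := fact_neq0 k; have : k.+1%:R != 0 :> K by rewrite pnatr_eq0.
by move=> *; field; apply/andP.
Qed.

Lemma scalef_exp c e : scalef c (expf e) = expf (c * e).
Proof. by apply: fpsP => k /=; rewrite exprMn mulrA. Qed.

End FpsExp.

(** * Residues against powers of the cotangent *)

(* Otherwise simplification unfolds every product into its convolution. *)
Arguments coef : simpl never.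

Section CotangentResidue.
Variable K : numFieldType.
Implicit Types (H k phi : fps K).

Let X := varf K.

(** The differential operator with constant coefficients that takes [H] to a
    series whose constant term is the residue at [0] of [cot ^+ n * H].  Its recursion comes from
    [(cot^(n+1))' = - (n+1) (cot^n + cot^(n+2))], because the residue of the
    derivative of [cot^(n+1) H] vanishes. *)
Fixpoint cot_residue n H : fps K :=
  match n with
  | 0 => 0
  | 1 => H
  | (n'.+1 as p).+1 =>
      constf p%:R^-1 * derivf (cot_residue p H) - cot_residue n' H
  end.

Lemma cot_residueSS n H : cot_residue n.+2 H =
  constf n.+1%:R^-1 * derivf (cot_residue n.+1 H) - cot_residue n H.
Proof. by []. Qed.

Lemma nat_ind2 (P : nat -> Prop) :
  P 0 -> P 1 -> (forall n, P n -> P n.+1 -> P n.+2) -> forall n, P n.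
Proof.
move=> P0 P1 PS n; suff: P n /\ P n.+1 by case.
by elim: n => // n [Pn PSn]; split=> //; apply: PS.
Qed.

Lemma cot_residue_deriv n H : cot_residue n (derivf H) = derivf (cot_residue n H).
Proof.
elim/nat_ind2: n => [||n IH IH1] //; first by rewrite raddf0.
by rewrite !cot_residueSS IH IH1 raddfB /= derivf_constM.
Qed.

(** For [phi = X cot X], the left-hand side is the residue of [cot ^+ n.+1 * H],
    and the differential equation is [cot' = - 1 - cot^2] freed of its pole.  The
    recursion [rec] below is the vanishing of the residue of a derivative: the
    coefficient of order [k] of [X F'] is [k] times that of [F]. *)
Lemma coef_cot_residue phi H n : coef phi 0 = 1 ->
  X * derivf phi = phi - phi ^+ 2 - X ^+ 2 ->
  coef (phi ^+ n.+1 * H) n = coef (cot_residue n.+1 H) 0.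
Proof.
move=> phi0 ode.
have rec p G : coef (phi ^+ p.+2 * G) p.+1 =
    p.+1%:R^-1 * coef (phi ^+ p.+1 * derivf G) p - coef (X ^+ 2 * (phi ^+ p * G)) p.+1.
  have nz : p.+1%:R != 0 :> K by rewrite pnatr_eq0.
  have E : p.+1%:R * (phi ^+ p.+2 * G) = p.+1%:R * (phi ^+ p.+1 * G)
      - X * derivf (phi ^+ p.+1 * G) + X * (phi ^+ p.+1 * derivf G)
      - p.+1%:R * (X ^+ 2 * (phi ^+ p * G)).
    rewrite derivfM derivfX mulrDr.
    have -> : X * (p.+1%:R * phi ^+ p * derivf phi * G)
        = p.+1%:R * phi ^+ p * G * (phi - phi ^+ 2 - X ^+ 2) by rewrite -ode; ring.
    by rewrite !exprS; ring.
  apply: (mulfI nz).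
  have := congr1 (fun a => coef a p.+1) E; rewrite /= !(coefBf, coefDf) !coef_natM.
  rewrite coef_varD coef_varM subrr add0r => ->.
  by rewrite [RHS]mulrBr mulVKf.
elim/nat_ind2: n H => [|| n IHn IHSn] H.
- by rewrite expr1 coefM0f phi0 mul1r.
- rewrite rec expr1 coefM0f phi0 cot_residueSS coefBf coef_constM mul1r.
  by rewrite -mulrA !coef_varM.
rewrite rec IHSn cot_residue_deriv [in RHS]cot_residueSS [in RHS]coefBf coef_constM.
by rewrite expr2 -mulrA 2!coef_varM IHn.
Qed.

(** The equation [k' = 1 + k^2] is that of [cot (x - z)] as a function of [z].
    It gives [(k^(n+1))' / (n+1) = k^n + k^(n+2)], so the recursion of
    [cot_residue] telescopes to [k ^+ n], up to a constant that depends on [n]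
    alone: this uniformity in [k] is what lets the constant disappear from a
    weighted sum with vanishing total weight. *)
Lemma cot_residue_riccati n : exists e : K, forall k,
  derivf k = 1 + k ^+ 2 -> cot_residue n k = k ^+ n + constf e.
Proof.
elim/nat_ind2: n => [||n [e IH] [e1 IH1]].
- by exists (-1) => k _; rewrite rmorphN1 subrr.
- by exists 0 => k _; rewrite rmorph0 addr0.
exists (- e) => k ric.
rewrite cot_residueSS IH // IH1 // raddfD /= derivf_const derivfX ric.
have cN : constf n.+1%:R^-1 * n.+1%:R = 1 :> fps K.
  by rewrite -(rmorph_nat (@constf K)) -rmorphM mulVf ?pnatr_eq0 // rmorph1.
rewrite -mulrA addr0 [constf _ * _]mulrA cN rmorphN !exprS; ring.
Qed.

End CotangentResidue.

(** * Power sums of cotangents *)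

Section PowerSums.
Variable K : numFieldType.
Variable ii : K.
Hypothesis sqr_ii : ii ^+ 2 = -1.

(** [cot x] as a rational function of [z = e^(2 i x)]. *)
Definition cotz (z : K) : K := ii * (z + 1) / (z - 1).

(** With [z = e^(2 i x)], the series [k] is the expansion of [cot (x - X)], that
    is of [i (q + 1) / (q - 1) = i (1 + 2 / (q - 1))] for [q = z e^(- 2 i X)]. *)
Lemma cot_series (z : K) : z != 1 -> exists2 G : fps K,
  (constf z * expf (- (2 * ii)) - 1) * G = 1 &
  let k := constf ii * (1 + 2 * G) in
  coef k 0 = cotz z /\ derivf k = 1 + k ^+ 2.
Proof.
move=> z1; set q := constf z * _.
have q0 : coef (q - 1) 0 != 0.
  by rewrite coefBf coef_constM coef0_expf mulr1 subr_eq0.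
exists (invfps (q - 1)); first exact: mulfps_inv.
set G := invfps _; have qG : (q - 1) * G = 1 by exact: mulfps_inv.
have dq : derivf q = - (2 * constf ii) * q.
  by rewrite derivf_constM derivf_exp rmorphN rmorphM rmorph_nat /q; ring.
have dG : derivf G = 2 * constf ii * (G + G ^+ 2).
  have := congr1 (@derivf K) qG.
  rewrite derivfM raddfB /= derivf1 subr0 dq => /(congr1 (fun x => G * x)) /=.
  rewrite mulr0 mulrDr => /eqP; rewrite addrC addr_eq0 mulrA [G * (q - 1)]mulrC qG mul1r.
  move=> /eqP ->.
  have -> : G + G ^+ 2 = (q - 1) * G * G + G ^+ 2 by rewrite qG mul1r.
  by ring.
split.
  rewrite coef_constM coefDf coef_natM coef1f /cotz.
  have := congr1 (fun a => coef a 0) qG; rewrite /= coefM0f coef1f /=.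
  rewrite coefBf coef_constM coef0_expf mulr1 coef1f /= => e.
  have nz : z - 1 != 0 by rewrite subr_eq0.
  have -> : coef G 0 = (z - 1)^-1 by apply: (mulfI nz); rewrite e mulfV.
  by field.
rewrite derivf_constM raddfD /= derivf1 add0r derivfM -(rmorph_nat (@constf K)).
rewrite derivf_const mul0r add0r dG.
have ii2 : constf ii ^+ 2 = -1 :> fps K by rewrite -rmorphXn /= sqr_ii rmorphN1.
rewrite exprMn ii2 rmorph_nat.
have -> : constf ii * (2 * (2 * constf ii * (G + G ^+ 2)))
  = 4 * constf ii ^+ 2 * (G + G ^+ 2) by ring.
by rewrite ii2; ring.
Qed.

(** Each power [cotz (w j) ^+ n.+1] is, up to a constant independent of [j], a
    residue against [cot ^+ n.+1] of the series of [cot (x_j - X)].  The weights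
    [w j ^+ m] have sum [0] and remove the constant, so everything reduces to the
    weighted sum of these series.  That sum is explicit: with [E = e^(- 2 i X)]
    and [q = w j * E], since [w j ^+ d = T],
    [1 / (q - 1)] is [1 / (T E ^+ d - 1)] times a geometric sum in [q],
    and among its [d] terms only the one of index [d - m] survives the summation
    over [j]. *)
Lemma power_sum_cot (phi A : fps K) (d m n : nat) (T : K) (w : 'I_d -> K) :
  coef phi 0 = 1 ->
  varf K * derivf phi = phi - phi ^+ 2 - varf K ^+ 2 ->
  T != 0 -> T != 1 -> (forall j, w j ^+ d = T) ->
  (forall s, (0 < s < d)%N -> \sum_j w j ^+ s = 0) ->
  (constf T^-1 * expf (2 * ii * d%:R) - 1) * A = 1 ->
  (0 < m < d)%N ->
  \sum_j w j ^+ m * cotz (w j) ^+ n.+1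
    = - (2 * ii * d%:R) * coef (phi ^+ n.+1 * (expf (2 * ii * m%:R) * A)) n.
Proof.
move=> phi0 ode T0 T1 wT sumw AT md.
have w1 j : w j != 1 by apply: contra_neq T1 => e; rewrite -(wT j) e expr1n.
have /(_ _)/cid2-/all_sig2[G wG kG] := fun j => cot_series (w1 j).
pose k j := constf ii * (1 + 2 * G j).
have [e ek] := @cot_residue_riccati K n.+1.
have sumwm : \sum_j w j ^+ m = 0 by exact: sumw.
have wk : \sum_j constf (w j ^+ m) * k j
    = constf (- (2 * ii * d%:R)) * (expf (2 * ii * m%:R) * A).
  pose E := expf (- (2 * ii)); pose B := expf (2 * ii * d%:R).
  have EX r : E ^+ r = expf (- (2 * ii * r%:R)).
    by rewrite -expf_natM; congr expf; ring.
  have EB : E ^+ d * B = 1 by rewrite EX -expfD addNr expf0.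
  have geo j : (constf T * E ^+ d - 1) * G j = \sum_(r < d) (constf (w j) * E) ^+ r.
    have -> : constf T * E ^+ d = (constf (w j) * E) ^+ d.
      by rewrite exprMn -rmorphXn /= wT.
    by rewrite subrX1 mulrAC wG mul1r.
  have sumw2 s : (0 < s < d + d)%N ->
      \sum_j w j ^+ s = if s == d then d%:R * T else 0.
    case: eqP => [-> _|sd sdd].
      by under eq_bigr do rewrite wT; rewrite sumr_const card_ord mulr_natl.
    have [lts|les] := ltnP s d; first by rewrite sumw //; lia.
    have wD j : w j ^+ s = w j ^+ (s - d) * T.
      by rewrite -(wT j) -exprD subnK.
    under eq_bigr do rewrite wD.
    by rewrite -mulr_suml sumw ?mul0r //; lia.
  pose S := \sum_j constf (w j ^+ m) * G j.
  have ES : (constf T * E ^+ d - 1) * S = constf (d%:R * T) * E ^+ (d - m).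
    rewrite mulr_sumr; under eq_bigr => j _.
      rewrite mulrCA geo mulr_sumr.
      under eq_bigr do rewrite exprMn -rmorphXn mulrA -rmorphM -exprD.
      over.
    rewrite exchange_big /=; under eq_bigr => r _.
      rewrite -mulr_suml -rmorph_sum sumw2; last by case: r => r /=; lia.
      over.
    have ltdm : (d - m < d)%N by case/andP: md; lia.
    rewrite (bigD1 (Ordinal ltdm)) //= ifT; last by apply/eqP; lia.
    rewrite big1 ?addr0 // => r; rewrite -val_eqE /= => ne.
    by rewrite ifN ?rmorph0 ?mul0r //; case: r ne => r /= ltr; lia.
  have TV : constf T^-1 * constf T = 1 :> fps K by rewrite -rmorphM mulVf // rmorph1.
  (* Multiplying by [A] inverts [T E ^+ d - 1 = - T E ^+ d (T^-1 B - 1)]. *)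
  have SE : S = - constf d%:R * (expf (2 * ii * m%:R) * A).
    rewrite -[S]mulr1 -AT -/B.
    have -> : constf T^-1 * B - 1 = - (constf T^-1 * B) * (constf T * E ^+ d - 1).
      transitivity (constf T^-1 * B - (constf T^-1 * constf T) * (E ^+ d * B)).
        by rewrite TV EB mulr1.
      by ring.
    transitivity (- (constf T^-1 * B) * ((constf T * E ^+ d - 1) * S) * A); first by ring.
    rewrite ES rmorphM.
    transitivity (- constf d%:R * (constf T^-1 * constf T) * (B * E ^+ (d - m)) * A).
      by ring.
    rewrite TV EX -expfD natrB; last by case/andP: md => _ /ltnW.
    have -> : 2 * ii * d%:R + - (2 * ii * (d%:R - m%:R)) = 2 * ii * m%:R by ring.
    by rewrite mulr1 mulrA.
  rewrite /k; under eq_bigr do rewrite mulrCA mulrDr mulr1 mulrCA.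
  rewrite -mulr_sumr big_split /= -rmorph_sum sumwm rmorph0 add0r -mulr_sumr -/S SE.
  by rewrite rmorphN !rmorphM !rmorph_nat; ring.
rewrite -coef_constM mulrCA -wk mulr_sumr coef_sumf; apply/esym.
under eq_bigr => j _.
  rewrite mulrCA coef_constM coef_cot_residue // ek; last by case: (kG j).
  rewrite coefDf coef_fpsX0 (proj1 (kG j)) mulrDr.
  over.
by rewrite big_split /= -[X in _ + X]mulr_suml sumwm mul0r addr0.
Qed.

End PowerSums.

(** * The expansions of x / (e^x - 1) and of x cot x *)

Section BernoulliCotangent.
Variable K : numFieldType.

Definition expm1_over_X : fps K := Fps (fun k => k.+1`!%:R^-1).
Definition bernf : fps K := invfps expm1_over_X.

Let X := varf K.
Let g := expm1_over_X.

Lemma varf_expm1_over_X : X * g = expf 1 - 1.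
Proof.
apply: fpsP => -[|k]; rewrite coef_varM coefBf coef1f /coef /= expr1n.
  by rewrite divr1 subrr.
by rewrite subr0 div1r.
Qed.

Lemma expm1_over_X_bernf : g * bernf = 1.
Proof. by apply: mulfps_inv; rewrite /coef /= invr1 oner_eq0. Qed.

Lemma bernf0 : coef bernf 0 = 1.
Proof.
have := congr1 (fun a => coef a 0) expm1_over_X_bernf.
by rewrite /= coefM0f coef1f {1}/coef /= invr1 mul1r.
Qed.

(** Differentiate [g * bernf = 1], where [X g = e^X - 1] makes [X g'] a
    polynomial expression in [g]. *)
Lemma bernf_ode : X * derivf bernf = bernf - bernf ^+ 2 - X * bernf.
Proof.
have gb := expm1_over_X_bernf.
have dX : derivf X = 1.
  apply: fpsP => k; rewrite coef1f /coef /=.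
  by case: k => [|k] /=; rewrite ?mul1r ?mulr0.
have dg : X * derivf g = X * g + 1 - g.
  have := congr1 (@derivf K) varf_expm1_over_X.
  rewrite derivfM dX mul1r raddfB /= derivf1 subr0 derivf_exp rmorph1 mul1r => e.
  by rewrite varf_expm1_over_X subrK -e addrAC subrr add0r.
have db : derivf g * bernf = - (g * derivf bernf).
  have := congr1 (@derivf K) gb; rewrite derivfM derivf1 => /eqP.
  by rewrite addr_eq0 => /eqP.
transitivity (X * (g * bernf) * derivf bernf); first by rewrite gb mulr1.
transitivity (- (bernf * (X * (derivf g * bernf)))); first by rewrite db; ring.
rewrite [X * (_ * _)]mulrA dg.
transitivity (- (g * bernf) * X * bernf - bernf ^+ 2 + (g * bernf) * bernf); first by ring.
by rewrite gb; ring.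
Qed.

(** [X / (e^X - 1) + X / 2 = (X / 2) coth (X / 2)]. *)
Definition cothf : fps K := bernf + constf 2^-1 * X.

Lemma cothf_ode : X * derivf cothf = cothf - cothf ^+ 2 + constf 4^-1 * X ^+ 2.
Proof.
have h2 : constf 2^-1 + constf 2^-1 = 1 :> fps K.
  by rewrite -rmorphD (_ : 2^-1 + 2^-1 = 1 :> K) ?rmorph1 //; field.
have h4 : constf 4^-1 = constf 2^-1 * constf 2^-1 :> fps K.
  by rewrite -rmorphM; congr constf; field.
have XdX : X * derivf X = X.
  by apply: fpsP => k; rewrite coef_varD /coef /=; case: eqP => [->|_]; rewrite ?mulr1 ?mulr0.
rewrite h4 /cothf raddfD /= derivf_constM mulrDr mulrCA XdX bernf_ode.
transitivity (bernf - bernf ^+ 2 - (constf 2^-1 + constf 2^-1) * X * bernf + constf 2^-1 * X).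
  by rewrite h2 mul1r.
by ring.
Qed.

Lemma cothf0 : coef cothf 0 = 1.
Proof. by rewrite coefDf bernf0 coef_constM /= mulr0 addr0. Qed.

(** In the recursion for a coefficient of odd order, each product of two
    coefficients of lower positive order contains one of odd order.  This is the
    parity of [(X / 2) coth (X / 2)], read off its differential equation. *)
Lemma odd_coef_riccati (a : fps K) : coef a 0 = 1 ->
  X * derivf a = a - a ^+ 2 + constf 4^-1 * X ^+ 2 ->
  forall k, odd k -> coef a k = 0.
Proof.
move=> a0 ode; elim/ltn_ind => -[//|k] IH oddk.
have : k.+2%:R * coef a k.+1 = 0.
  have := congr1 (fun a => coef a k.+1) ode.
  rewrite /= coef_varD coefDf coefBf expr2 coefMf.
  rewrite big_ord_recl big_ord_recr big1 /=; last first.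
    move=> -[i /= lti] _; rewrite /bump /= add1n.
    have [oi|ei] := boolP (odd i.+1); first by rewrite IH ?mul0r // ltnS.
    by rewrite [X in _ * X]IH ?mulr0 //; [lia|rewrite oddB ?oddk //= ltnW].
  have -> : coef (constf 4^-1 * X ^+ 2) k.+1 = 0.
    rewrite coef_constM expr2 coef_varM; case: k {IH} oddk => [|[|k]] //= _;
      by rewrite /coef /= mulr0.
  rewrite add0r subnn subn0 a0 mul1r mulr1 addr0 => e.
  by rewrite [k.+2%:R]mulrS mulrDl e; ring.
by move/eqP; rewrite mulf_eq0 pnatr_eq0 /= => /eqP.
Qed.

Variable ii : K.
Hypothesis sqr_ii : ii ^+ 2 = -1.

(** [X cot X], through [cot z = i coth (i z)]. *)
Definition cotf : fps K := scalef (2 * ii) cothf.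

Lemma cotf0 : coef cotf 0 = 1.
Proof. by rewrite /coef /= expr0 mul1r -/(coef _ 0) cothf0. Qed.

Lemma cotf_ode : X * derivf cotf = cotf - cotf ^+ 2 - X ^+ 2.
Proof.
have c4 : constf 4^-1 * constf (2 * ii) ^+ 2 = -1 :> fps K.
  rewrite -rmorphXn -rmorphM exprMn sqr_ii (_ : 4^-1 * (2 ^+ 2 * -1) = -1) ?rmorphN1 //.
  by field.
rewrite -scalef_varD cothf_ode rmorphD rmorphB !rmorphXn rmorphM /= scalef_const.
by rewrite rmorphXn /= scalef_var exprMn [constf 4^-1 * _]mulrA c4 mulN1r.
Qed.

Lemma cotf_odd k : odd k -> coef cotf k = 0.
Proof. by move=> oddk; rewrite /coef /= -/(coef _ k) (odd_coef_riccati cothf0 cothf_ode) ?mulr0. Qed.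

Lemma cotf_even j :
  coef cotf (2 * j) = (-1) ^+ j * 2 ^+ (2 * j) * coef bernf (2 * j).
Proof.
transitivity ((2 * ii) ^+ (2 * j) * coef cothf (2 * j)) => //.
rewrite coefDf coef_constM [coef X _]/coef /= ifN; last by apply/eqP; lia.
by rewrite mulr0 addr0 exprMn exprM [ii ^+ _]exprM sqr_ii [(-1) ^+ _ * _]mulrC.
Qed.

End BernoulliCotangent.

Lemma mapf_bernf (K L : numFieldType) (f : {rmorphism K -> L}) :
  mapf f (bernf K) = bernf L.
Proof.
apply: (@right_inverse_unique _ (expm1_over_X L)); last exact: expm1_over_X_bernf.
have -> : expm1_over_X L = mapf f (expm1_over_X K).
  by apply: fpsP => k; rewrite /coef /= fmorphV rmorph_nat.
by rewrite -rmorphM expm1_over_X_bernf rmorph1.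
Qed.

(** * Coefficients of products *)

Section CoefficientExpansion.
Variable K : comNzRingType.
Implicit Types a e phi : fps K.

Lemma eqmodX_sum_mono N a :
  eqmodX N a (\sum_(k < N) monof (coef a k) k).
Proof.
move=> k ltkN; rewrite coef_sumf (bigD1 (Ordinal ltkN)) //= big1 ?addr0.
  by rewrite /coef /= eqxx.
by move=> i; rewrite -val_eqE /coef /= eq_sym => /negbTE ->.
Qed.

Lemma eqmodX_sum_mono_even N a : (forall k, odd k -> coef a k = 0) ->
  eqmodX N a (\sum_(k < N) monof (coef a (2 * k)) (2 * k)).
Proof.
move=> aodd k ltkN; rewrite coef_sumf.
have [ok|ek] := boolP (odd k).
  rewrite aodd // big1 // => i _; rewrite /coef /= ifN //.
  by apply: contraTN ok => /eqP ->; rewrite oddM.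
have k2 : (2 * k./2)%N = k by rewrite mul2n even_halfK.
have ltk2 : (k./2 < N)%N by apply: leq_ltn_trans ltkN; lia.
rewrite (bigD1 (Ordinal ltk2)) //= big1 ?addr0; first by rewrite /coef /= k2 eqxx.
move=> i; rewrite -val_eqE /coef /= => ne; rewrite ifN //.
by apply: contraNN ne => /eqP ->; rewrite mul2n doubleK.
Qed.

Lemma prod_mono (I : finType) (c : I -> K) (l : I -> nat) :
  \prod_i monof (c i) (l i) = monof (\prod_i c i) (\sum_i l i)%N.
Proof.
elim/big_rec3: _ => [|i x y z _ ->]; first by apply: fpsP => -[|k].
by rewrite monofM.
Qed.

Lemma coef_even_exp_mul phi e a n : (forall k, odd k -> coef phi k = 0) ->
  coef (phi ^+ n.+1 * (e * a)) n =
  \sum_(j : {ffun 'I_n.+1 -> 'I_n.+1}) \sum_(mu < n.+1) \sum_(nu < n.+1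
      | (2 * (\sum_(r < n.+1) j r) + mu + nu == n)%N)
    (\prod_(r < n.+1) coef phi (2 * j r)) * (coef e mu * coef a nu).
Proof.
move=> phi_odd.
have eqphi := @eqmodX_exp _ n.+1 _ _ n.+1 (eqmodX_sum_mono_even phi_odd).
have eqea := eqmodXM (@eqmodX_sum_mono n.+1 e) (@eqmodX_sum_mono n.+1 a).
rewrite (eqmodXM eqphi eqea) //.
have -> (s : fps K) : s ^+ n.+1 = \prod_(r < n.+1) s by rewrite prodr_const card_ord.
rewrite bigA_distr_bigA mulr_suml coef_sumf; apply: eq_bigr => j _.
rewrite prod_mono mulr_suml mulr_sumr coef_sumf; apply: eq_bigr => mu _.
rewrite !mulr_sumr coef_sumf [RHS]big_mkcond; apply: eq_bigr => nu _.
by rewrite !monofM /coef /= -big_distrr /= addnA eq_sym.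
Qed.

End CoefficientExpansion.

(** * Uniqueness of power series expansions *)

Section PowerSeries.
Local Open Scope classical_set_scope.
Variable K : numFieldType.
Implicit Types (u v : nat -> K).

Lemma cvg_norm_le u v (l : K) :
  (forall n, `|u n - l| <= v n) -> v @ \oo --> (0 : K) -> u @ \oo --> l.
Proof.
move=> uv /cvgrPdist_lt v0; apply/cvgrPdist_lt => e e0.
near=> n; rewrite distrC (le_lt_trans (uv n)) //.
have vn : 0 <= v n by apply: le_trans (uv n).
rewrite -(ger0_norm vn) -[v n]subr0 distrC.
by near: n; exact: v0.
Unshelve. all: by end_near. Qed.

Lemma geometric_half_le2 (t : K) n : 0 <= t <= 2^-1 -> \sum_(k < n) t ^+ k <= 2.
Proof.
move=> /andP[t0 t2]; elim: n => [|n IH]; first by rewrite big_ord0.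
rewrite big_ord_recl expr0; under eq_bigr do rewrite lift0 exprS.
rewrite -mulr_sumr (le_trans (lerD (lexx _) (ler_pM t0 (sumr_ge0 _ _) t2 IH))) //.
  by move=> i _; exact: exprn_ge0.
by rewrite mulVf ?pnatr_eq0.
Qed.

(** At a point [t p] close to [0], the terms of positive order are dominated by a
    geometric series and cannot compensate a nonzero constant term. The origin is
    excluded from the hypothesis so that the next lemma can divide by [z]. *)
Lemma power_series_eq0_coef0 (c : nat -> K) (r : K) : 0 < r ->
  (forall z, 0 < `|z| < r -> (fun n => \sum_(k < n) c k * z ^+ k) @ \oo --> (0 : K)) ->
  c 0 = 0.
Proof.
move=> r0 cz; apply/eqP; apply/negPn/negP => c0.
pose p := r / 2.
have p0 : 0 < p by rewrite divr_gt0.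
have pr : p < r by rewrite ltr_pdivrMr // mulr_natr mulr2n ltrDl.
have Sp : (fun n => \sum_(k < n) c k * p ^+ k) @ \oo --> (0 : K).
  by apply: cz; rewrite gtr0_norm // p0 pr.
have [M M0 SM] : exists2 M : K, 0 < M & forall n, `|\sum_(k < n) c k * p ^+ k| < M.
  have /(cvg_seq_bounded (V := K))/ex_strict_bound_gt0 : cvgn (fun n => \sum_(k < n) c k * p ^+ k).
    by apply/cvg_ex; exists 0.
  by case=> M M0 SM; exists M => // n; exact: SM.
have cM n : `|c n * p ^+ n| <= 2 * M.
  have -> : c n * p ^+ n = \sum_(k < n.+1) c k * p ^+ k - \sum_(k < n) c k * p ^+ k.
    by rewrite big_ord_recr /= addrAC subrr add0r.
  by rewrite (le_trans (ler_normB _ _)) // mulr_natl mulr2n lerD // ltW.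
pose al := `|c 0|; have al0 : 0 < al by rewrite normr_gt0.
(* [t] is small enough for the tail to be at most half of [c 0]. *)
pose den := 8 * M + 2 * al.
have den0 : 0 < den by rewrite addr_gt0 // mulr_gt0.
have half_den : 2^-1 * den = 4 * M + al by rewrite /den; field.
pose t := al / den; have t0 : 0 < t by rewrite divr_gt0.
have t2 : t <= 2^-1.
  by rewrite ler_pdivrMr // half_den lerDr mulr_ge0 // ltW.
have Mt : 2 * M * (t * 2) <= al / 2.
  have -> : 2 * M * (t * 2) = al * ((4 * M) / den) by rewrite /t; ring.
  by rewrite ler_pM2l // ler_pdivrMr // half_den lerDl ltW.
have tail n : `|\sum_(k < n) c k.+1 * (t * p) ^+ k.+1| <= al / 2.
  apply: le_trans Mt; apply: le_trans (ler_norm_sum _ _ _) _.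
  apply: (@le_trans _ _ (2 * M * (t * \sum_(k < n) t ^+ k))); last first.
    rewrite ler_pM2l ?mulr_gt0 // ler_pM2l // geometric_half_le2 // t2.
    by rewrite ltW.
  rewrite !mulr_sumr ler_sum // => k _.
  rewrite exprMn [t ^+ _ * _]mulrC mulrA normrM [`|t ^+ _|]ger0_norm ?exprn_ge0 ?(ltW t0) //.
  by rewrite -exprS ler_wpM2r // exprn_ge0 // ltW.
have : (fun n => \sum_(k < n) c k * (t * p) ^+ k) @ \oo --> (0 : K).
  have tp0 : 0 < t * p by exact: mulr_gt0.
  apply: cz; rewrite gtr0_norm // tp0 /=.
  apply: le_lt_trans pr; rewrite ler_piMl ?(ltW p0) // (le_trans t2) //.
  by rewrite invf_le1 ?ler1n.
move=> /cvgrPdist_lt /(_ (al / 2)); rewrite divr_gt0 // => /(_ isT) [N _ /(_ N.+1 (leqnSn N)) /=].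
rewrite sub0r normrN big_ord_recl expr0 mulr1 => lt1.
have lt2 := le_lt_trans (lerB_normD _ _) lt1.
have := ltr_leD lt2 (tail N).
under eq_bigr do rewrite lift0.
by rewrite subrK -splitr ltxx.
Qed.

Lemma power_series_eq0 (c : nat -> K) (r : K) : 0 < r ->
  (forall z, 0 < `|z| < r -> (fun n => \sum_(k < n) c k * z ^+ k) @ \oo --> (0 : K)) ->
  forall k, c k = 0.
Proof.
move=> r0 cz k; elim: k c cz => [|k IH] c cz.
  exact: power_series_eq0_coef0 cz.
apply: (IH (fun j => c j.+1)) => z zr.
have z0 : z != 0 by rewrite -normr_gt0; case/andP: zr.
have c0 : c 0 = 0 by exact: power_series_eq0_coef0 cz.
have := cz z zr; rewrite -cvg_shiftS => cS.
have -> : (fun n => \sum_(j < n) c j.+1 * z ^+ j)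
    = (fun n => z^-1 * \sum_(j < n.+1) c j * z ^+ j).
  apply/funext => n; rewrite big_ord_recl c0 mul0r add0r mulr_sumr.
  by apply: eq_bigr => j _; rewrite lift0 exprS mulrCA mulKf.
by rewrite -[0 in X in _ --> X](mulr0 z^-1); apply: cvgM => //; exact: cvg_cst.
Qed.

Lemma is_expansion0_unique (f : K -> K) (c c' : nat -> K) :
  is_expansion0 f c -> is_expansion0 f c' -> c = c'.
Proof.
move=> fc fc'; have [r r0 H] : exists2 r : K, 0 < r & forall z, `|z| < r ->
    series (fun k => c k / k`!%:R * z ^+ k) @ \oo --> f z /\
    series (fun k => c' k / k`!%:R * z ^+ k) @ \oo --> f z.
  have [r /= r0 rP] : nbhs_ball (0 : K) (fun z =>
      series (fun k => c k / k`!%:R * z ^+ k) @ \oo --> f z /\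
      series (fun k => c' k / k`!%:R * z ^+ k) @ \oo --> f z).
    by rewrite nbhs_ballE; apply: filterI; [exact: fc|exact: fc'].
  exists r => // z zr; apply: rP; rewrite -ball_normE /= sub0r normrN //.
have e0 : forall k, (c k - c' k) / k`!%:R = 0.
  apply: (power_series_eq0 r0) => z /andP[_ /H[h h']].
  have -> : (fun n => \sum_(k < n) (c k - c' k) / k`!%:R * z ^+ k) =
      series (fun k => c k / k`!%:R * z ^+ k) \- series (fun k => c' k / k`!%:R * z ^+ k).
    apply/funext => n; rewrite /series /= !big_mkord -sumrB.
    by apply: eq_bigr => k _; rewrite -mulrBl -mulrBl.
  by rewrite -(subrr (f z)); exact: cvgB h h'.
apply/funext => k; apply/eqP; rewrite -subr_eq0; have /eqP := e0 k.
by rewrite mulf_eq0 invr_eq0 (negbTE (fact_neq0 _ _)) orbF.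
Qed.

End PowerSeries.

(** * Expansions of inverses *)

Section PartialSums.
Variable K : comNzRingType.
Implicit Types a b : fps K.

Definition psum a n : K := \sum_(k < n) coef a k.

Lemma sum_triangle (V : nmodType) (F : nat -> nat -> V) n :
  \sum_(k < n) \sum_(i < k.+1) F i (k - i)%N
    = \sum_(i < n) \sum_(j < n | (i + j < n)%N) F i j.
Proof.
under eq_bigr => k _ do rewrite (big_ord_widen n (fun i => F i (k - i)%N)) //.
rewrite (exchange_big_dep xpredT) //=; apply: eq_bigr => i _.
under eq_bigl do rewrite ltnS.
rewrite -(big_mkord (fun k => i <= k)%N (fun k => F i (k - i)%N)).
rewrite -(big_mkord (fun j => i + j < n)%N (F i)).
rewrite -(@big_nat_widenl _ _ _ i 0 n xpredT) //.
rewrite -{1}[nat_of_ord i]add0n big_addn.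
rewrite (big_nat_widen 0 (n - i) n) ?leq_subr //=.
by apply: eq_big => [j|j _]; rewrite ?addnK // ltn_subRL.
Qed.

Lemma psumM a b n : psum a n * psum b n = psum (a * b) n
    + \sum_(i < n) \sum_(j < n | (n <= i + j)%N) coef a i * coef b j.
Proof.
rewrite /psum; under [X in _ = X + _]eq_bigr do rewrite coefMf.
rewrite (sum_triangle (fun i j => coef a i * coef b j)) -big_split /=.
rewrite mulr_suml; apply: eq_bigr => i _; rewrite mulr_sumr.
rewrite (bigID (fun j : 'I_n => i + j < n)%N) /=; congr (_ + _).
by apply: eq_bigl => j; rewrite -leqNgt.
Qed.

Lemma psumBM a b n : psum a n * psum b n - psum (a * b) n =
  \sum_(i < n) \sum_(j < n | (n <= i + j)%N) coef a i * coef b j.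
Proof. by rewrite psumM addrAC subrr add0r. Qed.

End PartialSums.

Section InverseExpansion.
Local Open Scope classical_set_scope.
Variable K : numFieldType.
Implicit Types a b : fps K.

(** The ratio [q = 1 + M / |a_0|] is the one for which the bound reproduces
    itself in the recursion defining [b]: [(q - 1)] times the sum of the first
    [k] powers of [q] is less than [q ^+ k]. *)
Lemma coef_inverse_bound a b (M : K) : a * b = 1 ->
  (forall k, `|coef a k| <= M) ->
  forall k, `|coef b k| <= `|coef a 0|^-1 * (1 + M / `|coef a 0|) ^+ k.
Proof.
move=> ab aM; set al := `|coef a 0|; set q := 1 + _.
have ab0 : coef a 0 * coef b 0 = 1 by rewrite -coefM0f ab.
have a0 : coef a 0 != 0.
  by apply/eqP => a0; move/eqP: ab0; rewrite a0 mul0r eq_sym oner_eq0.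
have al0 : 0 < al by rewrite normr_gt0.
have M0 : 0 <= M by apply: le_trans (aM 0).
have q1 : 1 <= q by rewrite lerDl divr_ge0 // ltW.
elim/ltn_ind => -[_|k IH].
  by rewrite expr0 mulr1 -[coef b 0]mul1r -[1](mulVf a0) -mulrA ab0 mulr1 normfV.
have rec : coef a 0 * coef b k.+1 = - \sum_(i < k.+1) coef a (k.+1 - i)%N * coef b i.
  apply/eqP; rewrite -addr_eq0; have := congr1 (fun x => coef x k.+1) ab.
  rewrite /= mulrC coefMf coef1f /= big_ord_recr /= subnn mulrC addrC => e.
  by rewrite -[X in _ == X]e; apply/eqP; congr (_ + _); apply: eq_bigr => i _; rewrite mulrC.
have qM : al^-1 * M = q - 1 by rewrite /q addrAC subrr add0r mulrC.
rewrite -(ler_pM2l al0) mulrA mulfV ?lt0r_neq0 // mul1r -normrM rec normrN.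
apply: le_trans (ler_norm_sum _ _ _) _.
apply: (@le_trans _ _ (\sum_(i < k.+1) M * (al^-1 * q ^+ i))).
  by apply: ler_sum => i _; rewrite normrM ler_pM // IH.
under eq_bigr do rewrite mulrA [M * _]mulrC qM.
by rewrite -mulr_sumr -subrX1 lerBlDr lerDl.
Qed.

Lemma psum_le_geometric (u : nat -> K) (N : K) n : 0 <= N ->
  (forall k, `|u k| <= N * 8^-1 ^+ k) -> `|\sum_(k < n) u k| <= N * 2.
Proof.
move=> N0 uN; apply: le_trans (ler_norm_sum _ _ _) _.
apply: (@le_trans _ _ (\sum_(k < n) N * 8^-1 ^+ k)); first exact: ler_sum.
rewrite -mulr_sumr ler_wpM2l // geometric_half_le2 // invr_ge0 ler0n /=.
by rewrite lef_pV2 ?posrE ?ltr0n // ler_nat.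
Qed.

Lemma psum_tail_bound (u v : nat -> K) (M N : K) n : 0 <= M -> 0 <= N ->
  (forall k, `|u k| <= M * 8^-1 ^+ k) -> (forall k, `|v k| <= N * 8^-1 ^+ k) ->
  `|\sum_(i < n.+1) \sum_(j < n.+1 | (n.+1 <= i + j)%N) u i * v j|
    <= M * N * 2^-1 ^+ n.
Proof.
move=> M0 N0 uM vN.
have e0 : 0 <= 8^-1 :> K by rewrite invr_ge0.
have e1 : 8^-1 <= 1 :> K by rewrite invf_le1 // ler1n.
have MN0 : 0 <= M * N by exact: mulr_ge0.
have bound (i j : nat) : (n.+1 <= i + j)%N -> `|u i * v j| <= M * N * 8^-1 ^+ n.+1.
  move=> ltn; rewrite normrM.
  apply: (@le_trans _ _ ((M * 8^-1 ^+ i) * (N * 8^-1 ^+ j))); first exact: ler_pM.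
  rewrite mulrACA ler_wpM2l // -exprD. exact: ler_wiXn2l.
apply: (@le_trans _ _ (\sum_(i < n.+1) \sum_(j < n.+1) M * N * 8^-1 ^+ n.+1)).
  apply: le_trans (ler_norm_sum _ _ _) _; apply: ler_sum => i _.
  apply: le_trans (ler_norm_sum _ _ _) _; rewrite big_mkcond; apply: ler_sum => j _.
  case: ifP => [/bound //|_]; apply: mulr_ge0 => //; exact: exprn_ge0.
rewrite !sumr_const !card_ord -mulrnA -[_ *+ (_ * _)]mulr_natr -[_ * _%:R]mulrA ler_wpM2l //.
apply: (@le_trans _ _ (2^-1 ^+ n.+1)).
  have -> : 2^-1 ^+ n.+1 = 8^-1 ^+ n.+1 * (2 ^ n.+1 * 2 ^ n.+1)%:R :> K.
    by rewrite natrM natrX -!exprMn; congr (_ ^+ _); field.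
  rewrite ler_wpM2l ?exprn_ge0 //.
  by rewrite ler_nat leq_mul // ltnW // ltn_expl.
rewrite exprS ler_piMl ?exprn_ge0 ?invr_ge0 ?ler0n //.
by rewrite invf_le1 ?ltr0n // ler1n.
Qed.

(** By [psumM] and [psum_tail_bound] the product of the partial sums of [a] and
    [b] tends to [1]. As those of [a] converge and those of [b] are bounded, [l]
    is nonzero and the partial sums of [b] converge, with no appeal to the
    completeness of [K]. *)
Lemma cvg_inverse_psum a b (M N l : K) : 
  (fun n => 2^-1 ^+ n) @ \oo --> (0 : K) ->
  a * b = 1 -> 
  (forall k, `|coef a k| <= M * 8^-1 ^+ k) ->
  (forall k, `|coef b k| <= N * 8^-1 ^+ k) ->
  psum a @ \oo --> l ->
  psum b @ \oo --> l^-1.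
Proof.
move=> half0 ab aM bN al.
have M0 : 0 <= M by rewrite -[M]mulr1 -[1](expr0 8^-1); apply: le_trans (aM 0).
have N0 : 0 <= N by rewrite -[N]mulr1 -[1](expr0 8^-1); apply: le_trans (bN 0).
have prod1 : (fun n => psum a n * psum b n) @ \oo --> (1 : K).
  rewrite -cvg_shiftS /=.
  apply: (@cvg_norm_le K _ (fun n => M * N * 2^-1 ^+ n)); last first.
    by rewrite -(mulr0 (M * N)); apply: cvgM; [exact: cvg_cst|exact: half0].
  move=> n; rewrite psumM ab [psum 1 _]big_ord_recl coef1f /= big1 ?addr0; last first.
    by [].
  rewrite addrAC subrr add0r.
  exact: psum_tail_bound.
have l0 : l != 0.
  apply/eqP => l0.
  have prod0 : (fun n => psum a n * psum b n) @ \oo --> (0 : K).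
    apply: (@cvg_norm_le K _ (fun n => `|psum a n| * (N * 2))).
      by move=> n; rewrite subr0 normrM ler_wpM2l // psum_le_geometric.
    rewrite -(mul0r (N * 2)); apply: cvgM; last exact: cvg_cst.
    have := cvg_norm al; rewrite l0 normr0; exact.
  have one0 : (1 : K) = 0 by apply: (cvg_unique _ prod1 prod0); exact: norm_hausdorff.
  by move/eqP: one0; rewrite oner_eq0.
have h : (fun n => psum a n * psum b n / psum a n) @ \oo --> l^-1.
  by rewrite -[l^-1]mul1r; apply: cvgM => //; exact: cvgV.
refine (cvg_trans _ h); apply: near_eq_cvg.
have nz : \forall n \near \oo, psum a n != 0 by exact: cvgr_neq0 l al l0.
apply: filterS nz => n nz /=.
by rewrite mulrAC mulfV // mul1r.
Qed.

Lemma cvg_inverse_near0 a b (M : K) :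
  (fun n => 2^-1 ^+ n) @ \oo --> (0 : K) -> a * b = 1 ->
  (forall k, `|coef a k| <= M) ->
  \forall z \near (0 : K), forall l : K,
    psum (scalef z a) @ \oo --> l -> psum (scalef z b) @ \oo --> l^-1.
Proof.
move=> half0 ab aM.
have M0 : 0 <= M by apply: le_trans (aM 0).
set q := 1 + M / `|coef a 0|.
have q1 : 1 <= q by rewrite lerDl divr_ge0.
have q0 : 0 < q by rewrite (lt_le_trans ltr01).
have r0 : 0 < (8 * q)^-1 by rewrite invr_gt0 mulr_gt0.
have zP z : `|z| < (8 * q)^-1 -> forall l : K,
    psum (scalef z a) @ \oo --> l -> psum (scalef z b) @ \oo --> l^-1; last first.
  have : nbhs_ball (0 : K) (fun z => forall l : K,
      psum (scalef z a) @ \oo --> l -> psum (scalef z b) @ \oo --> l^-1).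
    exists (8 * q)^-1 => // z; rewrite -ball_normE /= sub0r normrN; exact: zP.
  by rewrite nbhs_ballE.
move=> zr l al.
have zq : `|z| * q <= 8^-1 by rewrite -ler_pdivlMr // -invfM ltW.
have z8 : `|z| <= 8^-1 by apply: le_trans zq; rewrite ler_peMr.
apply: (@cvg_inverse_psum (scalef z a) _ M `|coef a 0|^-1) => //.
- by rewrite -rmorphM ab rmorph1.
- move=> k; rewrite [coef _ _]/coef /= normrM normrX mulrC.
  by rewrite ler_pM ?exprn_ge0 ?lerXn2r ?nnegrE ?invr_ge0.
move=> k; rewrite [coef _ _]/coef /= normrM normrX.
apply: le_trans (ler_wpM2l _ (coef_inverse_bound ab aM k)) _; first exact: exprn_ge0.
rewrite mulrCA -exprMn ler_wpM2l ?invr_ge0 // lerXn2r ?nnegrE ?invr_ge0 //.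
by rewrite mulr_ge0 // ltW.
Qed.

(** The passage from analysis to algebra: numbers defined by the expansion of a
    reciprocal become coefficients of a formal inverse. *)
Lemma expansion0_inverse a b (M : K) (f : K -> K) :
  (fun n => 2^-1 ^+ n) @ \oo --> (0 : K) -> a * b = 1 ->
  (forall k, `|coef a k| <= M) ->
  (forall z, psum (scalef z a) @ \oo --> f z) ->
  expansion0 (fun z => (f z)^-1) = (fun k => k`!%:R * coef b k).
Proof.
move=> half0 ab aM af.
have bf : is_expansion0 (fun z => (f z)^-1) (fun k => k`!%:R * coef b k).
  have near0 := cvg_inverse_near0 half0 ab aM.
  apply: filterS near0 => z /(_ _ (af z)).
  suff -> : series (fun k => k`!%:R * coef b k / k`!%:R * z ^+ k) = psum (scalef z b) by [].
  apply/funext => n; rewrite /series /= big_mkord.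
  apply: eq_bigr => k _.
  by rewrite [k`!%:R * _]mulrC mulfK ?fact_neq0 // mulrC.
by apply: xget_unique => // c fc; exact: is_expansion0_unique fc bf.
Qed.

End InverseExpansion.

(** * The numbers A_nu(t) and B_k as coefficients of formal series *)

Section FieldSequences.
Local Open Scope classical_set_scope.
Variables (K : numFieldType) (u v : nat -> K) (l m : K).
Hypotheses (ul : u @ \oo --> l) (vm : v @ \oo --> m).

Lemma cvg_seqD : (fun n => u n + v n) @ \oo --> l + m. Proof. exact: cvgD. Qed.
Lemma cvg_seqB : (fun n => u n - v n) @ \oo --> l - m. Proof. exact: cvgB. Qed.
Lemma cvg_seqM : (fun n => u n * v n) @ \oo --> l * m. Proof. exact: cvgM. Qed.
Lemma cvg_seqMl c : (fun n => c * u n) @ \oo --> c * l.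
Proof. by apply: cvgM => //; exact: cvg_cst. Qed.

End FieldSequences.

Section ComplexExpansions.
Local Open Scope classical_set_scope.
Variable R : realType.
(* The topology used on [R[i]] is the one carried by any [numFieldType]. *)
Local Notation C := (Num.NumField.clone R[i] _).
Implicit Types (x y : R) (z t : R[i]).

Lemma norm_real_complex x : `|x%:C%C| = `|x|%:C%C.
Proof. by rewrite normc_def /= expr0n addr0 sqrtr_sqr. Qed.

Lemma cvg_real_complex (u : nat -> R) (l : R) :
  u @ \oo --> l -> (fun n => (u n)%:C%C : C) @ \oo --> (l%:C%C : C).
Proof.
move=> /cvgrPdist_lt ul; apply/cvgrPdist_lt => e.
rewrite ltcE => /andP[/eqP /= e0 /ul]; apply: filterS => n.
by rewrite -rmorphB norm_real_complex ltcE /= e0 eqxx.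
Qed.

Lemma cvg_half_real : (fun n => 2^-1 ^+ n) @ \oo --> (0 : R).
Proof. by apply: cvg_expr; rewrite ger0_norm ?invr_ge0 // invf_lt1 // ltr1n. Qed.

Lemma cvg_half_complex : (fun n => 2^-1 ^+ n : C) @ \oo --> (0 : C).
Proof.
have := cvg_real_complex cvg_half_real.
suff -> : (fun n => (2^-1 ^+ n)%:C%C) = (fun n => 2^-1 ^+ n) :> (nat -> R[i]) by [].
by apply/funext => n; rewrite rmorphXn fmorphV rmorph_nat.
Qed.

Lemma cvg_psum_expf_real x : psum (expf x) @ \oo --> expR x.
Proof.
have -> : psum (expf x) = series (exp_coeff x).
  by apply/funext => n; rewrite /series /= big_mkord.
exact: is_cvg_series_exp_coeff.
Qed.

Lemma coef_expf_imaginary y k :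
  coef (expf (y%:C%C * 'i%C)) k = (cos_coeff y k)%:C%C + 'i%C * (sin_coeff y k)%:C%C.
Proof.
have iE : coef (expf (y%:C%C * 'i%C)) k = 'i%C ^+ k * (y ^+ k / k`!%:R)%:C%C.
  by rewrite /coef /= rmorphM rmorphXn fmorphV rmorph_nat exprMn mulrAC mulrC mulrA.
rewrite iE /cos_coeff /sin_coeff /= -exprnP -{1}(odd_double_half k).
have i2 j : 'i%C ^+ j.*2 = ((-1) ^+ j)%:C%C :> R[i].
  by rewrite -mul2n exprM sqr_i rmorphXn rmorphN1.
case: (boolP (odd k)) => ok /=.
  have -> : k.-1./2 = k./2 by lia.
  by rewrite add1n exprS i2 !mul0r add0r mul1r -!mulrA -rmorphM.
by rewrite add0n i2 !mul0r mulr0 addr0 mul1r -rmorphM mulrA.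
Qed.

Lemma cvg_psum_expf_imaginary y :
  (psum (expf (y%:C%C * 'i%C)) : nat -> C) @ \oo --> ((cos y +i* sin y)%C : C).
Proof.
have -> : psum (expf (y%:C%C * 'i%C)) = (fun n =>
    (series (cos_coeff y) n)%:C%C + 'i%C * (series (sin_coeff y) n)%:C%C).
  apply/funext => n; rewrite /psum /series /= !big_mkord !rmorph_sum mulr_sumr -big_split.
  by apply: eq_bigr => k _; rewrite coef_expf_imaginary.
rewrite [X in _ --> X]complexE /=; apply: (@cvg_seqD C).
  apply: cvg_real_complex; rewrite unlock; exact: is_cvg_series_cos_coeff.
apply: (@cvg_seqMl C); apply: cvg_real_complex; rewrite unlock.
exact: is_cvg_series_sin_coeff.
Qed.

Lemma norm_coef_expf z x k : `|z| = x%:C%C ->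
  `|coef (expf z) k| = (coef (expf x) k)%:C%C.
Proof.
move=> zx; rewrite /coef /= normrM normrX zx normfV normr_nat.
by rewrite rmorphM rmorphXn fmorphV rmorph_nat.
Qed.

(** The Cauchy product of the two exponentials is controlled by the same
    computation on the moduli, where it is the addition law of [expR]. *)
Lemma cvg_psum_expf z : (psum (expf z) : nat -> C) @ \oo --> (expC z : C).
Proof.
case: z => x y.
pose v n := psum (expf `|x|) n * psum (expf `|y|) n - psum (expf (`|x| + `|y|)) n.
have v0 : v @ \oo --> (0 : R).
  rewrite -(subrr (expR (`|x| + `|y|))) {1}expRD.
  by apply: cvgB; [apply: cvgM|]; exact: cvg_psum_expf_real.
have zE : expf (x +i* y)%C = expf x%:C%C * expf (y%:C%C * 'i%C).
  by rewrite -expfD; congr expf; rewrite [LHS]complexE /= [_ * 'i%C]mulrC.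
have tail : (fun n => psum (expf x%:C%C) n * psum (expf (y%:C%C * 'i%C)) n
    - psum (expf (x +i* y)%C) n : C) @ \oo --> (0 : C).
  apply: (@cvg_norm_le C _ (fun n => (v n)%:C%C)); last first.
    by rewrite -(rmorph0 (real_complex R)); exact: cvg_real_complex.
  move=> n; rewrite subr0 /v zE expfD !psumBM.
  rewrite rmorph_sum; apply: le_trans (ler_norm_sum _ _ _) _; apply: ler_sum => i _.
  rewrite rmorph_sum; apply: le_trans (ler_norm_sum _ _ _) _; apply: ler_sum => j _.
  rewrite normrM rmorphM (norm_coef_expf _ (norm_real_complex x)).
  rewrite (@norm_coef_expf _ `|y|) // normrM norm_real_complex.
  have -> : `|'i%C| = 1 :> R[i] by rewrite normc_def /= expr0n add0r expr1n sqrtr1.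
  by rewrite mulr1.
have realE : psum (expf x%:C%C) = (fun n => (psum (expf x) n)%:C%C).
  apply/funext => n; rewrite /psum rmorph_sum; apply: eq_bigr => k _.
  by rewrite /coef /= rmorphM rmorphXn fmorphV rmorph_nat.
have cvg_real : (psum (expf x%:C%C) : nat -> C) @ \oo --> ((expR x)%:C%C : C).
  by rewrite realE; exact/cvg_real_complex/cvg_psum_expf_real.
have := cvg_seqB (cvg_seqM cvg_real (@cvg_psum_expf_imaginary y)) tail.
rewrite subr0; apply: cvg_trans; apply: near_eq_cvg; apply: nearW => n /=.
by rewrite subKr.
Qed.

Lemma cvg_psum1 (K : numFieldType) : psum (1 : fps K) @ \oo --> (1 : K).
Proof.
rewrite -cvg_shiftS; suff -> : (fun n => psum (1 : fps K) n.+1) = fun=> 1 by exact: cvg_cst.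
by apply/funext => n; rewrite /psum big_ord_recl big1 ?addr0.
Qed.

Lemma AcoefE t (A : fps R[i]) nu : (constf t * expf 1 - 1) * A = 1 ->
  Acoef nu t = nu`!%:R * coef A nu.
Proof.
move=> tA; rewrite /Acoef (@expansion0_inverse _ _ A (`|t| + 1) _ cvg_half_complex tA) //.
  move=> k; rewrite coefBf coef_constM coef1f.
  apply: le_trans (ler_normB _ _) _; apply: lerD; last by case: eqP => _; rewrite ?normr1 ?normr0.
  rewrite normrM ler_piMr // /coef /= expr1n div1r normfV normr_nat.
  by rewrite invf_le1 ?ler1n ?ltr0n fact_gt0.
move=> z; rewrite rmorphB rmorphM rmorph1 /= scalef_const scalef_exp mulr1.
have -> : psum (constf t * expf z - 1) = (fun n => t * psum (expf z) n - psum 1 n).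
  apply/funext => n; rewrite /psum mulr_sumr -sumrB; apply: eq_bigr => k _.
  by rewrite coefBf coef_constM.
apply: (@cvg_seqB C); last exact: cvg_psum1.
exact/(@cvg_seqMl C)/cvg_psum_expf.
Qed.

Lemma bernoulli_numE k : bernoulli_num R k = k`!%:R * coef (bernf R) k.
Proof.
(* The inverse of [bernoulli_gen], with its own singularity at [0] filled in. *)
pose f x : R := if x == 0 then 1 else (expR x - 1) / x.
have fE : @bernoulli_gen R = (fun x => (f x)^-1).
  by apply/funext => x; rewrite /bernoulli_gen /f; case: ifP; rewrite ?invr1 ?invf_div.
rewrite /bernoulli_num fE.
rewrite (@expansion0_inverse _ _ (bernf R) 1 _ cvg_half_real (expm1_over_X_bernf R)) //.
  by move=> j; rewrite /coef /= normfV normr_nat invf_le1 ?ler1n ?ltr0n fact_gt0.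
move=> x; rewrite /f; case: eqP => [->|/eqP x0].
  have -> : scalef 0 (expm1_over_X R) = 1.
    apply: fpsP => -[|j]; rewrite /coef /=; first by rewrite expr0 divr1.
    by rewrite expr0n mul0r.
  exact: cvg_psum1.
have -> : psum (scalef x (expm1_over_X R)) = (fun n => (psum (expf x) n.+1 - 1) / x).
  apply/funext => n; rewrite /psum big_ord_recl coef0_expf addrAC subrr add0r mulr_suml.
  by apply: eq_bigr => j _; rewrite lift0 /coef /= exprS [RHS]mulrAC [x * _]mulrC mulfK.
apply: cvgM; last exact: cvg_cst.
apply: cvgB; last exact: cvg_cst.
by rewrite cvg_shiftS; exact: cvg_psum_expf_real.
Qed.

End ComplexExpansions.

(** * Points of the unit circle *)

Section UnitCircle.
Variable R : realType.
Implicit Types x y : R.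

Definition cis x : R[i] := (cos x +i* sin x)%C.

Lemma expC_imaginary x : expC (x%:C%C * 'i%C) = cis x.
Proof.
have -> : x%:C%C * 'i%C = (0 +i* x)%C.
  by apply/eqP; rewrite eq_complex /=; apply/andP; split; apply/eqP; ring.
by rewrite /expC /= expR0 rmorph1 mul1r.
Qed.

Lemma expC_imaginaryN x : expC (- (x%:C%C * 'i%C)) = cis (- x).
Proof. by rewrite -mulNr -rmorphN expC_imaginary. Qed.

Lemma cisD x y : cis (x + y) = cis x * cis y.
Proof. by rewrite /cis cosD sinD; congr (_ +i* _)%C; rewrite addrC mulrC [sin x * _]mulrC. Qed.

Lemma cis0 : cis 0 = 1.
Proof. by rewrite /cis cos0 sin0. Qed.

Lemma cisNM x : cis (- x) * cis x = 1.
Proof. by rewrite -cisD addNr cis0. Qed.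

Lemma cis_neq0 x : cis x != 0.
Proof. by apply/eqP => x0; have /eqP := cisNM x; rewrite x0 mulr0 eq_sym oner_eq0. Qed.

Lemma cisN x : cis (- x) = (cis x)^-1.
Proof. by apply: (mulIf (cis_neq0 x)); rewrite cisNM mulVf // cis_neq0. Qed.

Lemma cisX x n : cis x ^+ n = cis (n%:R * x).
Proof.
elim: n => [|n IH]; first by rewrite mul0r cis0.
by rewrite exprS IH -cisD [n.+1%:R]mulrS mulrDl mul1r.
Qed.

Lemma sin_pi_eq0 x : sin (pi * x) = 0 -> exists k : int, x = k%:~R.
Proof.
move=> sx; exists (Num.floor x); apply/eqP; rewrite eq_sym eq_le ge_floor /=.
rewrite leNgt; apply/negP => ltx.
have := sin_gt0_pi (x := pi * (x - (Num.floor x)%:~R)).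
rewrite mulr_gt0 ?pi_gt0 ?subr_gt0 //= gtr_pMr ?pi_gt0 // ltrBlDr addrC.
have := floorD1_gt x; rewrite intrD => -> /(_ isT).
suff -> : sin (pi * (x - (Num.floor x)%:~R)) = 0 by rewrite ltxx.
case: (Num.floor x) => [p|p].
  have := alternatingn (@sinDpi R) p (pi * (x - p%:~R)).
  have -> : pi * (x - p%:~R) + pi *+ p = pi * x by rewrite -mulr_natr -pmulrn; ring.
  by rewrite sx => /esym/eqP; rewrite mulf_eq0 signr_eq0 => /eqP.
have := alternatingn (@sinDpi R) p.+1 (pi * x).
rewrite sx mulr0 NegzE => e; rewrite -[RHS]e; congr sin.
by rewrite -mulr_natr rmorphN /= -pmulrn; ring.
Qed.

Lemma cis_2pi_eq1 x : cis (2 * pi * x) = 1 -> exists k : int, x = k%:~R.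
Proof.
move=> /(congr1 (@complex.Re R)) /= c1; apply: sin_pi_eq0; apply/eqP.
have : cos (2 * pi * x) = 1 - sin (pi * x) ^+ 2 *+ 2.
  have -> : 2 * pi * x = (pi * x) *+ 2 by rewrite -mulr_natr; ring.
  by rewrite cos_mulr2n cos2sin2 mulrnBl addrAC mulr2n addrK.
move/eqP; rewrite c1 eq_sym -subr_eq0 addrAC subrr add0r.
by rewrite oppr_eq0 mulrn_eq0 /= sqrf_eq0.
Qed.

Lemma sin_cis x : (sin x)%:C%C = (cis x - cis (- x)) / (2 * 'i%C).
Proof.
have i2 : 2 * 'i%C != 0 :> R[i].
  by rewrite mulf_neq0 ?pnatr_eq0 // -sqrf_eq0 sqr_i oppr_eq0 oner_eq0.
apply: (mulIf i2); rewrite divfK //.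
rewrite /cis cosN sinN.
apply/eqP; rewrite eq_complex /=; apply/andP; split; apply/eqP; ring.
Qed.

Lemma cot_cis x : cis (2 * x) != 1 -> (cot x)%:C%C = cotz 'i%C (cis (2 * x)).
Proof.
have z2 : cis (2 * x) = cis x ^+ 2 by rewrite cisX.
have cE : cis x = (cos x)%:C%C + 'i%C * (sin x)%:C%C by rewrite [LHS]complexE.
have cs : (cos x)%:C%C ^+ 2 + (sin x)%:C%C ^+ 2 = 1 :> R[i].
  by rewrite -!rmorphXn -rmorphD cos2Dsin2.
have ii := sqr_i R.
set c := (cos x)%:C%C in cE cs *; set s := (sin x)%:C%C in cE cs *.
have z1 : cis (2 * x) - 1 = 2 * 'i%C * s * cis x.
  transitivity ((c + 'i%C * s) ^+ 2 - (c ^+ 2 + s ^+ 2)); first by rewrite cs z2 cE.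
  rewrite cE.
  transitivity (2 * 'i%C * s * c + ('i%C ^+ 2 - 1) * s ^+ 2); first by ring.
  transitivity (2 * 'i%C * s * c + 2 * 'i%C ^+ 2 * s ^+ 2); last by ring.
  by rewrite ii; ring.
have z1' : cis (2 * x) + 1 = 2 * c * cis x.
  transitivity ((c + 'i%C * s) ^+ 2 + (c ^+ 2 + s ^+ 2)); first by rewrite cs z2 cE.
  rewrite cE.
  transitivity (2 * c * (c + 'i%C * s) + ('i%C ^+ 2 + 1) * s ^+ 2); first by ring.
  by rewrite ii addNr mul0r addr0.
rewrite -subr_eq0 z1 => nz.
have [s0 i0] : s != 0 /\ 'i%C != 0 :> R[i].
  by move: nz; rewrite !mulf_eq0 !negb_or => /andP[/andP[/andP[_ ->] ->] _].
rewrite /cotz z1 z1' /cot fmorph_div -/c -/s.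
by field; rewrite s0 i0 cis_neq0.
Qed.

End UnitCircle.

Lemma cotzV (K : numFieldType) (ii z : K) : z != 0 -> z != 1 -> cotz ii z^-1 = - cotz ii z.
Proof.
move=> z0 z1; rewrite /cotz.
have z1' : z - 1 != 0 by rewrite subr_eq0.
have z1'' : 1 + -1 * z != 0 by rewrite mulN1r subr_eq0 eq_sym.
by field; rewrite z0 z1'.
Qed.

(** * The two halves of the trigonometric sum *)

Section TrigonometricSum.
Variable R : realType.

Lemma cis_sum0 (d s : nat) (b : R) : (0 < s < d)%N ->
  \sum_(j < d) cis (2 * pi * (j%:R / d%:R + b)) ^+ s = 0.
Proof.
move=> /andP[s0 sd]; have d0 : d%:R != 0 :> R by rewrite pnatr_eq0; lia.
pose om := cis (2 * pi * (s%:R / d%:R : R)).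
have -> : \sum_(j < d) cis (2 * pi * (j%:R / d%:R + b)) ^+ s
    = cis (s%:R * (2 * pi * b)) * \sum_(j < d) om ^+ j.
  rewrite mulr_sumr; apply: eq_bigr => j _.
  by rewrite !cisX -cisD; congr cis; field.
have om1 : om != 1.
  apply/eqP => /cis_2pi_eq1[k sk].
  have : 0 < s%:R / d%:R :> R by rewrite divr_gt0 ?ltr0n //; lia.
  have : s%:R / d%:R < 1 :> R by rewrite ltr_pdivrMr ?mul1r ?ltr_nat ?ltr0n //; lia.
  by rewrite sk ltr0z -[1]/(1%:~R) ltr_int; lia.
have omd : om ^+ d = 1.
  rewrite cisX -(cis0 R).
  have -> : d%:R * (2 * pi * (s%:R / d%:R)) = s%:R * (pi *+ 2) :> R.
    by rewrite -mulr_natr; field.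
  by rewrite -cisX /cis cos2pi sin2pi cos0 sin0 expr1n.
have : (om - 1) * \sum_(j < d) om ^+ j = 0 by rewrite -subrX1 omd subrr.
by move/eqP; rewrite mulf_eq0 subr_eq0 (negbTE om1) => /eqP ->; rewrite mulr0.
Qed.

Lemma Dcoef_cotf n (j : 'I_n -> nat) :
  (Dcoef R j)%:C%C = \prod_(r < n) coef (cotf ('i%C : R[i])) (2 * j r).
Proof.
rewrite rmorph_prod; apply: eq_bigr => r _; rewrite (cotf_even (sqr_i R)).
rewrite -(mapf_bernf (real_complex R)) /Ccoef bernoulli_numE -mulrA.
rewrite [_`!%:R * _]mulrC mulfK ?fact_neq0 // !rmorphM !rmorphXn rmorphN1.
by rewrite rmorph_nat.
Qed.

(** The expansion of [1 / (t e^(c z) - 1)] at [z = 0], for [t] different from [1]. *)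
Definition Aseries (t c : R[i]) : fps R[i] :=
  scalef c (invfps (constf t * expf 1 - 1)).

Lemma Aseries_inverse t c : t != 1 -> (constf t * expf c - 1) * Aseries t c = 1.
Proof.
move=> t1; rewrite /Aseries.
have -> : constf t * expf c - 1 = scalef c (constf t * expf 1 - 1).
  by rewrite rmorphB rmorphM rmorph1 /= scalef_const scalef_exp mulr1.
rewrite -rmorphM mulfps_inv ?rmorph1 // coefBf coef_constM coef0_expf mulr1.
by rewrite subr_eq0.
Qed.

Lemma coef_Aseries t c nu : t != 1 ->
  coef (Aseries t c) nu = c ^+ nu * (Acoef nu t / nu`!%:R).
Proof.
move=> t1; have At : (constf t * expf 1 - 1) * invfps (constf t * expf 1 - 1) = 1.
  by apply: mulfps_inv; rewrite coefBf coef_constM coef0_expf mulr1 subr_eq0.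
by rewrite (AcoefE nu At) [nu`!%:R * _]mulrC mulfK ?fact_neq0.
Qed.

Lemma cis_expd (d : nat) (b : R) (j : 'I_d) : 
  cis (2 * pi * (j%:R / d%:R + b)) ^+ d = cis (2 * pi * d%:R * b).
Proof.
have d0 : d%:R != 0 :> R by rewrite pnatr_eq0 -lt0n (leq_ltn_trans _ (ltn_ord j)).
rewrite cisX.
have -> : d%:R * (2 * pi * (j%:R / d%:R + b)) = j%:R * (pi *+ 2) + 2 * pi * d%:R * b.
  by rewrite -mulr_natr; field.
by rewrite cisD -cisX {1}/cis cos2pi sin2pi expr1n mul1r.
Qed.

(** The coefficient of order [n] of the product is the residue at [0] of
    [cot^(n+1) z * e^(2 i m z) / (t e^(2 i d z) - 1)]. *)
Definition kernel_residue (d m n : nat) (t : R[i]) : R[i] :=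
  coef (cotf 'i%C ^+ n.+1 * (expf (2 * 'i%C * m%:R)
    * Aseries t (2 * 'i%C * d%:R))) n.

Lemma kernel_residueE d m n t : t != 1 ->
  kernel_residue d m n t =
  \sum_(j : {ffun 'I_n.+1 -> 'I_n.+1}) \sum_(mu < n.+1) \sum_(nu < n.+1
      | (2 * (\sum_(r < n.+1) j r) + mu + nu == n)%N)
    (Dcoef R (fun r => j r : nat))%:C%C * ((2 * 'i%C * m%:R) ^+ mu / mu`!%:R
      * ((2 * 'i%C * d%:R) ^+ nu * (Acoef nu t / nu`!%:R))).
Proof.
move=> t1; rewrite /kernel_residue coef_even_exp_mul; last exact: cotf_odd.
apply: eq_bigr => j _; apply: eq_bigr => mu _; apply: eq_bigr => nu _.
by rewrite Dcoef_cotf coef_Aseries.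
Qed.

Section Halves.
Variables (d m n : nat) (b : R).
Hypotheses (md : (0 < m < d)%N) (T1 : cis (2 * pi * d%:R * b) != 1).

Let w (j : 'I_d) := cis (2 * pi * (j%:R / d%:R + b)).

Lemma cot_power_sum :
  \sum_j w j ^+ m * cotz 'i%C (w j) ^+ n.+1
  = - (2 * 'i%C * d%:R) * kernel_residue d m n (cis (- (2 * pi * d%:R * b))).
Proof.
apply: (@power_sum_cot _ _ (sqr_i R) _ _ _ _ _ (cis (2 * pi * d%:R * b)) w) => //.
- exact: cotf0.
- exact: cotf_ode (sqr_i R).
- exact: cis_neq0.
- exact: cis_expd.
- by move=> s; exact: cis_sum0.
by rewrite cisN Aseries_inverse // invr_eq1.
Qed.

(** The inverses of the [w j] are the roots of [z ^+ d = T^-1], where [T] is the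
    common value of the [w j ^+ d]. *)
Lemma cot_power_sum_inv :
  \sum_j (w j)^-1 ^+ m * cotz 'i%C (w j)^-1 ^+ n.+1
  = - (2 * 'i%C * d%:R) * kernel_residue d m n (cis (2 * pi * d%:R * b)).
Proof.
apply: (@power_sum_cot _ _ (sqr_i R) _ _ _ _ _ (cis (2 * pi * d%:R * b))^-1
  (fun j => (w j)^-1)) => //.
- exact: cotf0.
- exact: cotf_ode (sqr_i R).
- by rewrite invr_eq0 cis_neq0.
- by rewrite invr_eq1.
- by move=> j; rewrite exprVn /w cis_expd.
- move=> s /andP[s0 sd].
  have wV j : (w j)^-1 ^+ s = w j ^+ (d - s) * (cis (2 * pi * d%:R * b))^-1.
    rewrite -(cis_expd b j) -/(w j) -[in X in _ / X](subnK (ltnW sd)) exprD invfM mulrA.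
    by rewrite mulfV ?expf_neq0 ?cis_neq0 // mul1r exprVn.
  under eq_bigr do rewrite wV.
  by rewrite -mulr_suml cis_sum0 ?mul0r //; lia.
by rewrite invrK Aseries_inverse.
Qed.

(** The sine in the summand of index [j] is
    [(e^(- 2 pi i m b) w_j^m - e^(2 pi i m b) w_j^(-m)) / (2 i)]; in the second
    term, the cotangent is turned into that of [(w j)^-1] at the price of the sign
    [(-1)^(n+1)]. The missing summand of index [0] vanishes with its sine. *)
Lemma sin_cot_sum :
  (\sum_(1 <= j < d) sin (2 * pi * m%:R * j%:R / d%:R)
     * cot (pi * j%:R / d%:R + pi * b) ^+ n.+1)%:C%C
  = - (d%:R * (cis (- (2 * pi * m%:R * b)) * kernel_residue d m n (cis (- (2 * pi * d%:R * b)))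
      + (-1) ^+ n * cis (2 * pi * m%:R * b) * kernel_residue d m n (cis (2 * pi * d%:R * b)))).
Proof.
have w1 j : w j != 1.
  by apply: contraNneq T1 => wj1; rewrite -(cis_expd b j) -/(w j) wj1 expr1n.
have i2 : 2 * 'i%C != 0 :> R[i].
  by rewrite mulf_neq0 ?pnatr_eq0 // -sqrf_eq0 sqr_i oppr_eq0 oner_eq0.
pose S := \sum_j w j ^+ m * cotz 'i%C (w j) ^+ n.+1.
pose S' := \sum_j (w j)^-1 ^+ m * cotz 'i%C (w j)^-1 ^+ n.+1.
transitivity ((2 * 'i%C)^-1 * (cis (- (2 * pi * m%:R * b)) * S
    - (-1) ^+ n.+1 * cis (2 * pi * m%:R * b) * S')); last first.
  have SE : S = - (2 * 'i%C * d%:R) * kernel_residue d m n (cis (- (2 * pi * d%:R * b))).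
    exact: cot_power_sum.
  have SE' : S' = - (2 * 'i%C * d%:R) * kernel_residue d m n (cis (2 * pi * d%:R * b)).
    exact: cot_power_sum_inv.
  rewrite SE SE'; set p := kernel_residue _ _ _ (cis (- _)); set p' := kernel_residue _ _ _ _.
  rewrite exprS; set c := cis (- _); set c' := cis _.
  transitivity (((2 * 'i%C)^-1 * (2 * 'i%C)) *
    - (d%:R * (c * p + (-1) ^+ n * c' * p'))); first by ring.
  by rewrite mulVf // mul1r.
transitivity ((\sum_(0 <= j < d) sin (2 * pi * m%:R * j%:R / d%:R)
   * cot (pi * j%:R / d%:R + pi * b) ^+ n.+1)%:C%C).
  have d_gt0 : (0 < d)%N by lia.
  by rewrite [in RHS]big_ltn // mulr0 mul0r sin0 mul0r add0r.
rewrite big_mkord rmorph_sum !mulr_sumr -sumrB mulr_sumr; apply: eq_bigr => j _.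
rewrite rmorphM rmorphXn /= sin_cis.
have wj0 : w j != 0 by exact: cis_neq0.
have xE : 2 * (pi * j%:R / d%:R + pi * b) = 2 * pi * (j%:R / d%:R + b) by ring.
rewrite cot_cis xE -/(w j) // cotzV // [(- cotz _ _) ^+ _]exprNn.
have -> : 2 * pi * m%:R * j%:R / d%:R
    = m%:R * (2 * pi * (j%:R / d%:R + b)) - 2 * pi * m%:R * b by ring.
rewrite opprB cisD -cisX -/(w j) [cis (_ - _)]cisD !cisN -[cis (m%:R * _)]cisX -/(w j) -exprVn.
move: (cotz _ _) (cis _) (cis _)^-1 => z c c'.
have sgn : (-1) ^+ n.+1 * (-1) ^+ n.+1 = 1 :> R[i] by rewrite -expr2 sqrr_sign.
transitivity ((2 * 'i%C)^-1 * (c' * (w j ^+ m * z ^+ n.+1)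
  - ((-1) ^+ n.+1 * (-1) ^+ n.+1) * c * ((w j)^-1 ^+ m * z ^+ n.+1))).
  by rewrite sgn; ring.
by ring.
Qed.

End Halves.

End TrigonometricSum.

(** * The theorem *)

(* The constraint 2 (j_1 + ... + j_n) + mu + nu = n - 1 forces every summation
   index to be < n, so letting them range over 'I_n loses no term. *)
Theorem theorem1p3 (R : realType) (m n d : nat) (b : R)
    (hm : (0 < m)%N) (hn : (0 < n)%N) (hd : (0 < d)%N) (hmd : (m < d)%N)
    (hb : ~ exists k : int, b = k%:~R / d%:R) :
  let t1 : R[i] := expC (- ((2 * pi * m%:R * b)%:C%C * 'i%C)) in
  let t2 : R[i] := expC (- ((2 * pi * d%:R * b)%:C%C * 'i%C)) in
  let t1' : R[i] := expC ((2 * pi * m%:R * b)%:C%C * 'i%C) in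
  let t2' : R[i] := expC ((2 * pi * d%:R * b)%:C%C * 'i%C) in
  (\sum_(1 <= j < d)
     sin (2 * pi * m%:R * j%:R / d%:R)
     * cot (pi * j%:R / d%:R + pi * b) ^+ n)%:C%C
  = - \sum_(j : {ffun 'I_n -> 'I_n}) \sum_(mu < n) \sum_(nu < n
          | (2 * (\sum_(r < n) j r) + mu + nu == n - 1)%N)
        'i%C ^+ (mu + nu) * 2 ^+ (mu + nu)
        * (m%:R ^+ mu / mu`!%:R) * (d%:R ^+ nu.+1 / nu`!%:R)
        * (t1 * Acoef nu t2 + (-1) ^+ (mu + nu) * t1' * Acoef nu t2')
        * (Dcoef R (fun r : 'I_n => j r : nat))%:C%C.
Proof.
move=> t1 t2 t1' t2'.
have t1E : t1 = cis (- (2 * pi * m%:R * b)) by exact: expC_imaginaryN.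
have t2E : t2 = cis (- (2 * pi * d%:R * b)) by exact: expC_imaginaryN.
have t1E' : t1' = cis (2 * pi * m%:R * b) by exact: expC_imaginary.
have t2E' : t2' = cis (2 * pi * d%:R * b) by exact: expC_imaginary.
have d0 : d%:R != 0 :> R by rewrite pnatr_eq0 -lt0n.
have t2neq1' : t2' != 1.
  apply/eqP; rewrite t2E' -mulrA => /cis_2pi_eq1[k dk].
  by apply: hb; exists k; rewrite -dk mulrC mulKf.
have t2neq1 : t2 != 1 by rewrite t2E cisN invr_eq1 -t2E'.
have md : (0 < m < d)%N by rewrite hm.
case: n hn => // n _; rewrite subn1 /=.
have T1 : cis (2 * pi * d%:R * b) != 1 by rewrite -t2E'.
apply: (etrans (sin_cot_sum n md T1)); rewrite -t1E -t1E' -t2E -t2E'.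
move: t1 t2 t1' t2' {t1E t2E t1E' t2E' T1} t2neq1 t2neq1' => t1 t2 t1' t2' t2neq1 t2neq1'.
congr (- _).
rewrite (kernel_residueE _ _ _ t2neq1) (kernel_residueE _ _ _ t2neq1').
rewrite !mulr_sumr -big_split mulr_sumr; apply: eq_bigr => j _.
rewrite !mulr_sumr -big_split mulr_sumr; apply: eq_bigr => mu _.
rewrite !mulr_sumr -big_split mulr_sumr; apply: eq_bigr => nu /eqP munu.
(* As [mu + nu] has the parity of [n], the sign is the same in every term. *)
have sgn : (-1) ^+ (mu + nu) = (-1) ^+ n :> R[i].
  by rewrite -[in RHS]munu -addnA [in RHS]exprD exprM sqrrN !expr1n mul1r.
rewrite sgn !exprMn !exprD exprS.
have alg (x y u v p q a a' D e f i i' : R[i]) :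
    x * (t1 * (D * (e * i * p * u * (f * i' * q * (a * v))))
      + y * t1' * (D * (e * i * p * u * (f * i' * q * (a' * v)))))
    = i * i' * (e * f) * (p * u) * (x * q * v) * (t1 * a + y * t1' * a') * D.
  by ring.
exact: alg.
Qed.
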